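(* Let $M$ be a manifold of dimension $n=6$. For every Riemannian metric $g$ on $M$ let $$\mathbf P_6(g)=\big[2(P_2P_4+P_4P_2)-3P_2^3\big]^0-48\,\delta(\mathsf P^2\# d)-8\,\delta(\mathcal B\# d).$$ Then $\mathbf P_6$ is conformally covariant, i.e. $$e^{6\varphi}\,\mathbf P_6(e^{2\varphi}g)=\mathbf P_6(g)$$ for all Riemannian metrics $g$ on $M$ and all $\varphi\in C^\infty(M)$.
   Context: Notation for a Riemannian metric $g$ in dimension $n$ (here $n=6$): $\Delta$ is the Laplacian with $-\Delta\ge0$; $\tau$ is the scalar curvature, $\mathsf J=\tau/(2(n-1))$; the Schouten tensor $\mathsf P$ is defined by $(n-2)\mathsf P=\mathrm{Ric}-\mathsf Jg$. $\mathsf P^2$ is formed by identifying $\mathsf P$ with an endomorphism of $TM$ via $g$. For a symmetric bilinear form $T$ and a $1$-form $\omega$, $T\#\omega$ is the $1$-form $X\mapsto T(\omega^\sharp,X)$; $\delta$ is the formal adjoint of $d$. For a differential operator $D$ on functions, $D^0=D-D(1)$ is its non-constant part. The Yamabe operator is $P_2=\Delta-(\frac n2-1)\mathsf J$. The Paneitz operator is $P_4=\Delta^2+\delta((n-2)\mathsf Jg-4\mathsf P)\# d+(\frac n2-2)(\frac n2\mathsf J^2-2|\mathsf P|^2-\Delta\mathsf J)$. The Bach-type tensor is $\mathcal B_{ij}=\Delta(\mathsf P)_{ij}-\nabla^k\nabla_j(\mathsf P)_{ik}+\mathsf P^{kl}\mathsf C_{kijl}$, where $\mathsf C$ is the Weyl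 tensor, i.e. the totally trace-free part of the Riemann tensor $R_{kijl}$ with sign convention such that $R_{kijl}=g_{kl}g_{ij}-g_{kj}g_{il}$ on the unit round sphere. *)

(* Defs.v *)
From HB Require Import structures.
From mathcomp Require Import all_boot all_order all_algebra.
From mathcomp Require Import all_classical all_reals all_analysis.
Import Order.TTheory GRing.Theory Num.Theory numFieldNormedType.Exports.

Set Implicit Arguments.
Unset Strict Implicit.
Unset Printing Implicit Defensive.

Local Open Scope classical_set_scope.
Local Open Scope ring_scope.

Section SmoothFunctions.
Context {R : realType} {n : nat}.
Implicit Types (U : set 'rV[R]_n) (f : 'rV[R]_n -> R).

Definition partial (i : 'I_n) f : 'rV[R]_n -> R :=
  fun x => 'D_(delta_mx 0 i) f x.

(* Meant for U open: then the iterated partial derivatives at a point of U do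
   not depend on the values of f outside U. *)
Definition smooth_on U f : Prop :=
  forall (s : seq 'I_n) (x : 'rV[R]_n), U x ->
    differentiable (foldr partial f s : 'rV[R]_n -> R) x.

End SmoothFunctions.

(* The atlas is not required to be maximal. Outside dom c and img c the values
   of to_chart c and of_chart c are irrelevant. *)
Record smoothManifold (R : realType) (n : nat) := SmoothManifold {
  carrier :> topologicalType;
  chart : Type;
  dom : chart -> set carrier;
  img : chart -> set 'rV[R]_n;
  to_chart : chart -> carrier -> 'rV[R]_n;
  of_chart : chart -> 'rV[R]_n -> carrier;
  manifold_hausdorff : hausdorff_space carrier;
  manifold_second_countable : @second_countable carrier;
  dom_cover : forall p : carrier, exists c, dom c p;
  open_dom : forall c, open (dom c);
  open_img : forall c, open (img c);
  to_chart_img : forall c p, dom c p -> img c (to_chart c p);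
  of_chart_dom : forall c x, img c x -> dom c (of_chart c x);
  to_chartK : forall c p, dom c p -> of_chart c (to_chart c p) = p;
  of_chartK : forall c x, img c x -> to_chart c (of_chart c x) = x;
  to_chart_continuous : forall c, {within dom c, continuous (to_chart c)};
  of_chart_continuous : forall c, {within img c, continuous (of_chart c)};
  transition_smooth : forall (c c' : chart) (k : 'I_n),
    smooth_on [set x | img c x /\ dom c' (of_chart c x)]
              (fun x => to_chart c' (of_chart c x) 0 k)
}.

Arguments chart {R n} M : rename.
Arguments dom {R n M} c _ : rename.
Arguments img {R n M} c _ : rename.
Arguments to_chart {R n M} c _ : rename.
Arguments of_chart {R n M} c _ : rename.

Section MetricsOnManifolds.
Context {R : realType} {n : nat} (M : smoothManifold R n).

Definition smooth_function (u : M -> R) : Prop :=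
  forall c : chart M, smooth_on (img c) (u \o of_chart c).

(* A field of bilinear forms on M is given by its matrix of components with
   respect to the coordinate frame of each chart. *)
Definition bilinear_field := chart M -> 'rV[R]_n -> 'M[R]_n.

(* dx'^k/dx^i in row i and column k, for the coordinates x of c and x' of c' *)
Definition transition_jacobian (c c' : chart M) (x : 'rV[R]_n) : 'M[R]_n :=
  \matrix_(i, k) partial i (fun y => to_chart c' (of_chart c y) 0 k) x.

Record riemannian_metric (g : bilinear_field) : Prop := RiemannianMetric {
  metric_smooth : forall (c : chart M) (i j : 'I_n),
    smooth_on (img c) (fun x => g c x i j);
  metric_sym : forall (c : chart M) x, img c x -> (g c x)^T = g c x;
  metric_posdef : forall (c : chart M) x, img c x ->
    forall v : 'rV[R]_n, v != 0 -> 0 < (v *m g c x *m v^T) 0 0;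
  metric_transition : forall (c c' : chart M) x,
    img c x -> dom c' (of_chart c x) ->
    g c x = transition_jacobian c c' x
              *m g c' (to_chart c' (of_chart c x))
              *m (transition_jacobian c c' x)^T
}.

(* e^{2 phi} g *)
Definition conformal_metric (phi : M -> R) (g : bilinear_field)
    : bilinear_field :=
  fun c x => expR (2 * phi (of_chart c x)) *: g c x.

End MetricsOnManifolds.

(* Riemannian geometry in coordinates, for the metric with components g *)
Section LocalGeometry.
Context {R : realType} {n : nat} (g : 'rV[R]_n -> 'M[R]_n).

Local Notation scal := ('rV[R]_n -> R).
Local Notation form := ('I_n -> scal).
Local Notation tens2 := ('I_n -> 'I_n -> scal).
Local Notation tens3 := ('I_n -> 'I_n -> 'I_n -> scal).
Local Notation tens4 := ('I_n -> 'I_n -> 'I_n -> 'I_n -> scal).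
Implicit Types (u : scal) (w : form) (T : tens2).

Definition gdn : tens2 := fun i j x => g x i j.
Definition gup : tens2 := fun i j x => invmx (g x) i j.

(* Gamma^k_{ij} *)
Definition christoffel (k i j : 'I_n) : scal := fun x =>
  2^-1 * \sum_m gup k m x * (partial i (gdn m j) x + partial j (gdn m i) x
                             - partial m (gdn i j) x).

(* (nabla_k w)_i = nabla1 w k i, (nabla_k T)_{ij} = nabla2 T k i j and
   (nabla_l S)_{kij} = nabla3 S l k i j: the first index is that of the
   derivative. *)
Definition nabla1 w : tens2 := fun k i x =>
  partial k (w i) x - \sum_m christoffel m k i x * w m x.

Definition nabla2 T : tens3 := fun k i j x =>
  partial k (T i j) x
  - \sum_m (christoffel m k i x * T m j x + christoffel m k j x * T i m x).

Definition nabla3 (S : tens3) : tens4 := fun l k i j x =>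
  partial l (S k i j) x
  - \sum_m (christoffel m l k x * S m i j x + christoffel m l i x * S k m j x
            + christoffel m l j x * S k i m x).

Definition grad_form u : form := fun i => partial i u.

(* The formal adjoint of d on 1-forms, i.e. minus the divergence *)
Definition codiff w : scal := fun x =>
  - \sum_i \sum_j gup i j x * nabla1 w i j x.

Definition laplacian u : scal := fun x =>
  \sum_i \sum_j gup i j x * nabla1 (grad_form u) i j x.

(* (T # w)_j = T(w^sharp, d_j) *)
Definition sharp_act T w : form := fun j x =>
  \sum_i T i j x * \sum_k gup i k x * w k x.

(* The component of d_m in
   nabla_{d_k} nabla_{d_i} d_j - nabla_{d_i} nabla_{d_k} d_j *)
Definition curvature (k i j m : 'I_n) : scal := fun x =>
  partial k (christoffel m i j) x - partial i (christoffel m k j) x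
  + \sum_a (christoffel m k a x * christoffel a i j x
            - christoffel m i a x * christoffel a k j x).

(* R_{kijl}; on the unit round sphere this is g_{kl} g_{ij} - g_{kj} g_{il} *)
Definition riemann : tens4 := fun k i j l x =>
  \sum_m gdn m l x * curvature k i j m x.

Definition ricci : tens2 := fun i j x =>
  \sum_k \sum_l gup k l x * riemann k i j l x.

Definition scalar_curvature : scal := fun x =>
  \sum_i \sum_j gup i j x * ricci i j x.

Definition Jcurv : scal := fun x => scalar_curvature x / (2 * (n%:R - 1)).

(* Meaningful for n > 2 only *)
Definition schouten : tens2 := fun i j x =>
  (ricci i j x - Jcurv x * gdn i j x) / (n%:R - 2).

Definition schouten_sq : tens2 := fun i j x =>
  \sum_k \sum_l schouten i k x * gup k l x * schouten l j x.

(* |P|^2 = P_{ij} P^{ij} *)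
Definition schouten_norm2 : scal := fun x =>
  \sum_i \sum_j \sum_k \sum_l
    gup i k x * gup j l x * schouten i j x * schouten k l x.

(* The totally trace-free part of riemann: what is subtracted is the
   Kulkarni-Nomizu product of g and the Schouten tensor. *)
Definition weyl : tens4 := fun k i j l x =>
  riemann k i j l x
  - (gdn k l x * schouten i j x - gdn k j x * schouten i l x
     + gdn i j x * schouten k l x - gdn i l x * schouten k j x).

(* B_{ij} = g^{kl} nabla_k nabla_l P_{ij} - g^{kl} nabla_l nabla_j P_{ik}
            + P^{kl} C_{kijl} *)
Definition bach : tens2 := fun i j x =>
  \sum_k \sum_l gup k l x * nabla3 (nabla2 schouten) k l i j x
  - \sum_k \sum_l gup k l x * nabla3 (nabla2 schouten) l j i k x
  + \sum_k \sum_l (\sum_a \sum_b gup k a x * gup l b x * schouten a b x)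
                  * weyl k i j l x.

Definition yamabe (u : scal) : scal := fun x =>
  laplacian u x - (n%:R / 2 - 1) * Jcurv x * u x.

Definition paneitz (u : scal) : scal := fun x =>
  laplacian (laplacian u) x
  + codiff (sharp_act (fun i j y => (n%:R - 2) * Jcurv y * gdn i j y
                                    - 4 * schouten i j y) (grad_form u)) x
  + (n%:R / 2 - 2) * (n%:R / 2 * Jcurv x ^+ 2 - 2 * schouten_norm2 x
                      - laplacian Jcurv x) * u x.

(* D^0 = D - D(1) *)
Definition nonconstant_part (D : scal -> scal) (u : scal) : scal := fun x =>
  D u x - D (fun=> 1) x * u x.

End LocalGeometry.

Definition P6_local {R : realType} (g : 'rV[R]_6 -> 'M[R]_6)
    (u : 'rV[R]_6 -> R) : 'rV[R]_6 -> R := fun x =>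
  let P2 := yamabe g in
  let P4 := paneitz g in
  nonconstant_part
    (fun v y => 2 * (P2 (P4 v) y + P4 (P2 v) y) - 3 * P2 (P2 (P2 v)) y) u x
  - 48 * codiff g (sharp_act g (schouten_sq g) (grad_form u)) x
  - 8 * codiff g (sharp_act g (bach g) (grad_form u)) x.

(* The function P_6(g) u on the domain of the chart c, computed in the
   coordinates of c *)
Definition P6 {R : realType} {M : smoothManifold R 6} (g : bilinear_field M)
    (c : chart M) (u : M -> R) : M -> R :=
  fun p => P6_local (g c) (u \o of_chart c) (to_chart c p).

(* Main.v *)
Require Import Defs.
From HB Require Import structures.
From mathcomp Require Import all_boot all_order all_algebra.
From mathcomp Require Import all_classical all_reals all_analysis.
From mathcomp Require Import ring lra.
Import Order.TTheory GRing.Theory Num.Theory numFieldNormedType.Exports.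

Local Open Scope classical_set_scope.
Local Open Scope ring_scope.

Set Implicit Arguments.
Unset Strict Implicit.
Unset Printing Implicit Defensive.

(** The two sides are the values at t = 1 and t = 0 of e^(6 t phi) P_6(g_t) u,
    where g_t = e^(2 t phi) g; the t-derivative of this function vanishes at
    every point.  All quantities built from g_t, phi and u are smooth functions
    of (t, x), and d/dt commutes with the coordinate derivatives.  So the
    derivative can be computed in a commutative ring with commuting derivations
    d_i (space) and tau (time) such that tau g = 2 phi g, and the problem
    becomes the infinitesimal covariance [tau_P6], which is algebra.

    Write L = P_2.  Then M = P_4 - L^2 is a second-order operator,
    4 div(P # d) plus a potential [panE], and
    2(L P_4 + P_4 L) - 3 L^3 = L^3 + 2(L M + M L).
    The covariance of L gives tau L = L tau - 4 phi L + 2 L phi, and the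
    variation of M contains, besides the terms of a covariant operator, the
    double commutator -[L,[L,phi]] [tau_M].  For
    K = L^3 + 2(L M + M L) all words of degree three in L then cancel in
    tau K + 6 phi K, and 2[L,[M,phi]] + 4[M,[L,phi]] is left [tau_K_comm].

    The commutators [L,phi] and [M,phi] are twice the skew-adjoint operators
    along the fields dphi and 4 P # dphi [sop_comm1].  The commutator of
    div(T # d) with the skew-adjoint operator along v is -div((L_v T) # d) up
    to a potential, L_v being the Lie derivative [dop_comm, sop_comm2]; this rests only on the identity
    div [v,w] = v(div w) - w(div v) [dvg_bracket].  Passing to the non-constant
    part removes the potential [tau_K0].

    There remains an identity between symmetric 2-tensors: the Lie derivatives
    found above must cancel the variations of P^2 and of the Bach tensor B.
    Here tau P = -Hess phi [tau_P], the Cotton tensor varies by the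
    contraction of the Weyl tensor with dphi [tau_cotton], and hence
    tau B + 2 phi B is n - 4 times a contraction of nabla P with dphi
    [tau_bach].

    On the analytic side, the ring consists of the smooth functions on R x U,
    U being the image of the chart [cinf]; its derivations commute by the
    symmetry of mixed derivatives [derive_comm]; and the quantities of the
    statement, at each time t, are evaluations of elements of the ring
    [rep_P6]. *)

(** * Derivations of commutative rings *)

Section Derivations.
Context {B : comPzRingType}.
Implicit Types (D : B -> B).

Definition derivation D :=
  (forall x y, D (x + y) = D x + D y) /\
  (forall x y, D (x * y) = D x * y + x * D y).

Context {D : B -> B} (hD : derivation D).

Lemma derD x y : D (x + y) = D x + D y. Proof. by case: hD. Qed.
Lemma derM x y : D (x * y) = D x * y + x * D y. Proof. by case: hD. Qed.
Lemma der0 : D 0 = 0.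
Proof. by apply: (@addIr _ (D 0)); rewrite -derD !add0r. Qed.
Lemma derN x : D (- x) = - D x.
Proof. by apply: (@addIr _ (D x)); rewrite -derD !addNr der0. Qed.
Lemma derB x y : D (x - y) = D x - D y. Proof. by rewrite derD derN. Qed.
Lemma der1 : D 1 = 0.
Proof.
apply: (@addIr _ (D 1)); rewrite add0r.
by rewrite -{3}[1]mulr1 derM mulr1 mul1r.
Qed.
Lemma derMn x m : D (x *+ m) = D x *+ m.
Proof. by elim: m => [|m IH]; rewrite ?mulr0n ?der0 // !mulrS derD IH. Qed.
Lemma der_nat m : D m%:R = 0.
Proof. by rewrite derMn der1 mul0rn. Qed.
Lemma der_sum (J : finType) (F : J -> B) : D (\sum_i F i) = \sum_i D (F i).
Proof. by apply: (big_morph D derD der0). Qed.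

Lemma map_mx_derM m p q (X : 'M[B]_(m, p)) (Y : 'M[B]_(p, q)) :
  map_mx D (X *m Y) = map_mx D X *m Y + X *m map_mx D Y.
Proof.
apply/matrixP => i j; rewrite !mxE der_sum -big_split /=.
by apply: eq_bigr => k _; rewrite derM !mxE.
Qed.

Lemma map_mx_derD m p (X Y : 'M[B]_(m, p)) :
  map_mx D (X + Y) = map_mx D X + map_mx D Y.
Proof. by apply/matrixP => i j; rewrite !mxE derD. Qed.

Lemma map_mx_derN m p (X : 'M[B]_(m, p)) : map_mx D (- X) = - map_mx D X.
Proof. by apply/matrixP => i j; rewrite !mxE derN. Qed.

End Derivations.

(** * Tensor calculus for a metric torsion-free connection *)

Section Tensors.
Context {B : comPzRingType} {n : nat}.
Context (d : 'I_n -> B -> B) (g gup : 'M[B]_n).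
Context (Gam : 'I_n -> 'I_n -> 'I_n -> B).

Local Notation form := ('I_n -> B).
Local Notation tens2 := ('I_n -> 'I_n -> B).
Local Notation tens3 := ('I_n -> 'I_n -> 'I_n -> B).
Local Notation tens4 := ('I_n -> 'I_n -> 'I_n -> 'I_n -> B).
Implicit Types (f : B) (w v : form) (S T : tens2) (X : tens3) (Y : tens4).

(** Tensors are kept covariant and indices are raised only inside contractions,
    so the inverse metric enters only through [tr]. *)
Definition tr S : B := \sum_i \sum_j gup i j * S i j.

Definition ip w v : B := tr (fun i j => w i * v j).

(** The action of the Christoffel symbols on one covariant slot. *)
Definition conn (k i : 'I_n) w : B := \sum_m Gam m k i * w m.

Definition nab1 w : tens2 := fun k i => d k (w i) - conn k i w.

Definition nab2 T : tens3 := fun k i j =>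
  d k (T i j) - (conn k i (T^~ j) + conn k j (T i)).

Definition nab3 X : tens4 := fun l k i j =>
  d l (X k i j) - (conn l k (fun m => X m i j) + conn l i (fun m => X k m j)
                   + conn l j (X k i)).

Definition nab4 Y (a : 'I_n) : tens4 := fun k i j l =>
  d a (Y k i j l) - (conn a k (fun m => Y m i j l)
                     + conn a i (fun m => Y k m j l)
                     + conn a j (fun m => Y k i m l) + conn a l (Y k i j)).

Definition df f : form := fun i => d i f.
Definition dvg w : B := tr (nab1 w).
Definition act T w : form := fun j => tr (fun i k => T i j * w k).
(** The operator div(T # d); for T = g it is the Laplacian. *)
Definition dop T f : B := dvg (act T (df f)).
Definition lap f : B := dvg (df f).

(** In this convention the covariant derivative of a row Z of contravariant
    components is d_a Z + Z *m gammx a, that of a column of covariant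
    components is d_a - gammx a, and [nabla_k, nabla_i] is right multiplication
    of rows by [curvmx k i]. *)
Definition gammx (a : 'I_n) : 'M[B]_n := \matrix_(j, m) Gam m a j.

Definition curvmx (k i : 'I_n) : 'M[B]_n :=
  map_mx (d k) (gammx i) - map_mx (d i) (gammx k)
  + (gammx i *m gammx k - gammx k *m gammx i).

Definition riem : tens4 := fun k i j l => (curvmx k i *m g) j l.
Definition ric : tens2 := fun i j => tr (fun k l => riem k i j l).
Definition scal : B := tr ric.

Lemma eq_tr S T : (forall i j, S i j = T i j) -> tr S = tr T.
Proof.
by move=> h; apply: eq_bigr => i _; apply: eq_bigr => j _; rewrite h.
Qed.

Lemma trD S T : tr (fun i j => S i j + T i j) = tr S + tr T.
Proof.
rewrite /tr -big_split; apply: eq_bigr => i _ /=.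
by rewrite -big_split; apply: eq_bigr => j _ /=; rewrite mulrDr.
Qed.

Lemma trZ f S : tr (fun i j => f * S i j) = f * tr S.
Proof.
rewrite /tr mulr_sumr; apply: eq_bigr => i _; rewrite mulr_sumr.
by apply: eq_bigr => j _; rewrite mulrCA.
Qed.

Lemma trN S : tr (fun i j => - S i j) = - tr S.
Proof.
by rewrite -mulN1r -trZ; apply: eq_tr => i j; rewrite mulN1r.
Qed.

Lemma tr0 : tr (fun _ _ => 0) = 0.
Proof. by rewrite /tr big1 // => i _; rewrite big1 // => j _; rewrite mulr0. Qed.

Lemma trB S T : tr (fun i j => S i j - T i j) = tr S - tr T.
Proof. by rewrite trD trN. Qed.

Lemma trZr f S : tr (fun i j => S i j * f) = tr S * f.
Proof. by rewrite mulrC -trZ; apply: eq_tr => i j; rewrite mulrC. Qed.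

Lemma tr_exchange Y :
  tr (fun i j => tr (fun k l => Y i j k l)) =
  tr (fun k l => tr (fun i j => Y i j k l)).
Proof.
rewrite /tr.
under eq_bigr => i _ do under eq_bigr => j _ do rewrite mulr_sumr.
under eq_bigr => i _ do rewrite exchange_big /=.
rewrite exchange_big /=; apply: eq_bigr => k _.
under eq_bigr => i _ do under eq_bigr => j _ do rewrite mulr_sumr.
under eq_bigr => i _ do rewrite exchange_big /=.
rewrite exchange_big /=; apply: eq_bigr => l _.
rewrite mulr_sumr; apply: eq_bigr => i _.
by rewrite mulr_sumr; apply: eq_bigr => j _; ring.
Qed.

Lemma eq_conn k i w v : (forall m, w m = v m) -> conn k i w = conn k i v.
Proof. by move=> h; apply: eq_bigr => m _; rewrite h. Qed.

Lemma connD k i w v : conn k i (fun m => w m + v m) = conn k i w + conn k i v.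
Proof.
by rewrite /conn -big_split; apply: eq_bigr => m _; rewrite /= mulrDr.
Qed.

Lemma connZ k i f w : conn k i (fun m => f * w m) = f * conn k i w.
Proof. by rewrite /conn mulr_sumr; apply: eq_bigr => m _; rewrite mulrCA. Qed.

Lemma connZr k i f w : conn k i (fun m => w m * f) = conn k i w * f.
Proof. by rewrite mulrC -connZ; apply: eq_conn => m; rewrite mulrC. Qed.

Lemma connN k i w : conn k i (fun m => - w m) = - conn k i w.
Proof. by rewrite -mulN1r -connZ; apply: eq_conn => m; rewrite mulN1r. Qed.

Lemma connB k i w v : conn k i (fun m => w m - v m) = conn k i w - conn k i v.
Proof. by rewrite connD connN. Qed.

Lemma conn_tr k i X :
  conn k i (fun m => tr (X m)) = tr (fun a b => conn k i (fun m => X m a b)).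
Proof.
rewrite /conn /tr.
under eq_bigr => m _ do rewrite mulr_sumr.
rewrite exchange_big; apply: eq_bigr => a _ /=.
under eq_bigr => m _ do rewrite mulr_sumr.
rewrite exchange_big; apply: eq_bigr => b _ /=.
by rewrite mulr_sumr; apply: eq_bigr => m _; rewrite mulrCA.
Qed.

Section Metric.
Hypothesis hd : forall i, derivation (d i).
Hypothesis dC : forall i j f, d i (d j f) = d j (d i f).
Hypothesis g_sym : g^T = g.
Hypothesis gup_sym : gup^T = gup.
Hypothesis gupg : gup *m g = 1%:M.
Hypothesis ggup : g *m gup = 1%:M.
Hypothesis Gam_sym : forall m i j, Gam m i j = Gam m j i.
Hypothesis metricity :
  forall k, map_mx (d k) g = gammx k *m g + g *m (gammx k)^T.

Lemma gC i j : g i j = g j i. Proof. by rewrite -{1}g_sym mxE. Qed.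
Lemma gupC i j : gup i j = gup j i. Proof. by rewrite -{1}gup_sym mxE. Qed.

Lemma tr_sym S : tr (fun i j => S j i) = tr S.
Proof.
rewrite /tr exchange_big; apply: eq_bigr => i _; apply: eq_bigr => j _ /=.
by rewrite gupC.
Qed.

Lemma ipC w v : ip w v = ip v w.
Proof. by rewrite /ip -tr_sym; apply: eq_tr => i j; rewrite mulrC. Qed.

Lemma tr_gl i w : tr (fun k l => g i k * w l) = w i.
Proof.
rewrite /tr exchange_big /=.
transitivity (\sum_l (1%:M : 'M[B]_n) i l * w l).
  apply: eq_bigr => l _; rewrite -ggup mxE mulr_suml.
  by apply: eq_bigr => k _; ring.
rewrite (bigD1 i) //= big1 ?addr0 ?mxE ?eqxx ?mul1r // => l /negPf.
by rewrite eq_sym mxE => ->; rewrite mul0r.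
Qed.

(** Every placement of the contracted index, so that a contraction with the
    metric is recognized without reordering the factors. *)
Lemma tr_gE :
  ((forall i w, tr (fun k l => g i k * w l) = w i)
   * (forall i w, tr (fun k l => g k i * w l) = w i)
   * (forall i w, tr (fun k l => g i l * w k) = w i)
   * (forall i w, tr (fun k l => g l i * w k) = w i))
  * ((forall i w, tr (fun k l => w l * g i k) = w i)
   * (forall i w, tr (fun k l => w l * g k i) = w i)
   * (forall i w, tr (fun k l => w k * g i l) = w i)
   * (forall i w, tr (fun k l => w k * g l i) = w i)).
Proof.
do ?apply: pair; move=> i w; rewrite -[RHS]tr_gl;
  first [by apply: eq_tr => k l; rewrite ?(gC k i) // mulrC ?(gC k i)
        |by rewrite -[LHS]tr_sym; apply: eq_tr => k l;
            rewrite ?(gC k i) // mulrC ?(gC k i)].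
Qed.

Lemma tr_g : tr (fun k l => g k l) = n%:R.
Proof.
rewrite /tr; transitivity (\sum_(k < n) (1 : B)); last first.
  by rewrite sumr_const card_ord.
apply: eq_bigr => k _; transitivity ((gup *m g) k k).
  by rewrite mxE; apply: eq_bigr => l _; rewrite (gC k l).
by rewrite gupg mxE eqxx.
Qed.

Lemma act_g w i : act (fun i j => g i j) w i = w i.
Proof. by rewrite -[RHS]tr_gl; apply: eq_tr => k l; rewrite gC. Qed.

Lemma der_gup k :
  map_mx (d k) gup = - (gup *m gammx k + (gammx k)^T *m gup).
Proof.
have h : map_mx (d k) (gup *m g) = 0.
  rewrite gupg; apply/matrixP => i j; rewrite !mxE.
  by rewrite (derMn (hd k)) (der1 (hd k)) mul0rn.
have : map_mx (d k) (gup *m g) *m gup = 0 by rewrite h mul0mx.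
rewrite (map_mx_derM (hd k)) metricity mulmxDl -(mulmxA (map_mx _ _)) ggup mulmx1.
move/eqP; rewrite addr_eq0 => /eqP ->; congr (- _).
by rewrite mulmxDr mulmxDl !mulmxA gupg mul1mx -(mulmxA _ g) ggup mulmx1.
Qed.

(** The inverse metric is parallel. *)
Lemma der_tr a S : d a (tr S) = tr (nab2 S a).
Proof.
rewrite trB trD {1}/tr (der_sum (hd a)).
under eq_bigr => i _ do rewrite (der_sum (hd a)).
have gupE i j : d a (gup i j) =
    - ((\sum_m gup i m * Gam j a m) + \sum_m gup m j * Gam i a m).
  have := congr1 (fun A : 'M[B]_n => A i j) (der_gup a); rewrite !mxE => ->.
  congr (- (_ + _)); apply: eq_bigr => m _; rewrite !mxE //.
  by rewrite mulrC.
have E1 : tr (fun i j => conn a i (S^~ j)) =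
    \sum_i \sum_j (\sum_m gup m j * Gam i a m) * S i j.
  rewrite /tr /conn exchange_big [RHS]exchange_big.
  apply: eq_bigr => j _ /=.
  under eq_bigr => i _ do rewrite mulr_sumr.
  rewrite exchange_big /=; apply: eq_bigr => m _; rewrite mulr_suml.
  by apply: eq_bigr => i _; ring.
have E2 : tr (fun i j => conn a j (S i)) =
    \sum_i \sum_j (\sum_m gup i m * Gam j a m) * S i j.
  rewrite /tr /conn; apply: eq_bigr => i _ /=.
  under eq_bigr => j _ do rewrite mulr_sumr.
  rewrite exchange_big /=; apply: eq_bigr => m _; rewrite mulr_suml.
  by apply: eq_bigr => j _; ring.
rewrite E1 E2 {1}/tr -big_split -sumrN -big_split; apply: eq_bigr => i _ /=.
rewrite -big_split -sumrN -big_split; apply: eq_bigr => j _ /=.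
by rewrite (derM (hd a)) gupE; ring.
Qed.

Lemma connC k i w : conn k i w = conn i k w.
Proof. by apply: eq_bigr => m _; rewrite Gam_sym. Qed.

Lemma nab1_tr X a j :
  nab1 (fun j => tr (X j)) a j = tr (fun k l => nab3 X a j k l).
Proof.
rewrite /nab1 der_tr conn_tr -trB; apply: eq_tr => k l.
by rewrite /nab2 /nab3; ring.
Qed.

Lemma nab2_tr_out Y a i j :
  nab2 (fun i j => tr (fun k l => Y k i j l)) a i j =
  tr (fun k l => nab4 Y a k i j l).
Proof.
rewrite /nab2 der_tr !conn_tr -trD -trB; apply: eq_tr => k l.
by rewrite /nab2 /nab4; ring.
Qed.

Lemma nab1D w v a i : nab1 (fun i => w i + v i) a i = nab1 w a i + nab1 v a i.
Proof. by rewrite /nab1 (derD (hd a)) connD; ring. Qed.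

Lemma nab1N w a i : nab1 (fun i => - w i) a i = - nab1 w a i.
Proof. by rewrite /nab1 (derN (hd a)) connN; ring. Qed.

Lemma nab1B w v a i : nab1 (fun i => w i - v i) a i = nab1 w a i - nab1 v a i.
Proof. by rewrite nab1D nab1N. Qed.

Lemma nab1Z f w a i :
  nab1 (fun i => f * w i) a i = d a f * w i + f * nab1 w a i.
Proof. by rewrite /nab1 (derM (hd a)) connZ; ring. Qed.

Lemma eq_nab1 w v a i : (forall j, w j = v j) -> nab1 w a i = nab1 v a i.
Proof. by move=> h; rewrite /nab1 h (eq_conn _ _ h). Qed.

Lemma eq_nab2 S T a i j :
  (forall i j, S i j = T i j) -> nab2 S a i j = nab2 T a i j.
Proof.
move=> h; rewrite /nab2 h (eq_conn _ _ (h i)).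
by rewrite (@eq_conn _ _ (S^~ j) (T^~ j)).
Qed.

Lemma nab2D S T a i j :
  nab2 (fun i j => S i j + T i j) a i j = nab2 S a i j + nab2 T a i j.
Proof. by rewrite /nab2 (derD (hd a)) !connD; ring. Qed.

Lemma nab2N S a i j : nab2 (fun i j => - S i j) a i j = - nab2 S a i j.
Proof. by rewrite /nab2 (derN (hd a)) !connN; ring. Qed.

Lemma nab2Z f S a i j :
  nab2 (fun i j => f * S i j) a i j = d a f * S i j + f * nab2 S a i j.
Proof. by rewrite /nab2 (derM (hd a)) !connZ; ring. Qed.

Lemma nab2_mul w v a i j :
  nab2 (fun i j => w i * v j) a i j = nab1 w a i * v j + w i * nab1 v a j.
Proof. by rewrite /nab2 /nab1 (derM (hd a)) connZ connZr; ring. Qed.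

Lemma nab3B X Z a i j k :
  nab3 (fun i j k => X i j k - Z i j k) a i j k = nab3 X a i j k - nab3 Z a i j k.
Proof. by rewrite /nab3 (derB (hd a)) !connB; ring. Qed.

Lemma nab3_rev X a i j k :
  nab3 (fun i j k => X k j i) a i j k = nab3 X a k j i.
Proof. by rewrite /nab3; ring. Qed.

Lemma nab4N Y a i j k l :
  nab4 (fun i j k l => - Y i j k l) a i j k l = - nab4 Y a i j k l.
Proof. by rewrite /nab4 (derN (hd a)) !connN; ring. Qed.

Lemma eq_nab3 X Z a i j k :
  (forall i j k, X i j k = Z i j k) -> nab3 X a i j k = nab3 Z a i j k.
Proof.
move=> h; rewrite /nab3 h (eq_conn _ _ (h i j)).
rewrite (@eq_conn _ _ (fun m => X m j k) (fun m => Z m j k)) //.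
by rewrite (@eq_conn _ _ (fun m => X i m k) (fun m => Z i m k)).
Qed.

Lemma eq_nab4 Y Z a i j k l :
  (forall i j k l, Y i j k l = Z i j k l) -> nab4 Y a i j k l = nab4 Z a i j k l.
Proof.
move=> h; rewrite /nab4 h (eq_conn _ _ (h i j k)).
rewrite (@eq_conn _ _ (fun m => Y m j k l) (fun m => Z m j k l)) //.
rewrite (@eq_conn _ _ (fun m => Y i m k l) (fun m => Z i m k l)) //.
by rewrite (@eq_conn _ _ (fun m => Y i j m l) (fun m => Z i j m l)).
Qed.

Lemma nab2_g a i j : nab2 (fun i j => g i j) a i j = 0.
Proof.
have := congr1 (fun A : 'M[B]_n => A i j) (metricity a); rewrite !mxE => E.
rewrite /nab2 E /conn; apply/eqP; rewrite subr_eq0; apply/eqP; congr (_ + _).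
  by apply: eq_bigr => m _; rewrite !mxE.
by apply: eq_bigr => m _; rewrite !mxE mulrC.
Qed.

Lemma nab2_sym S a i j : (forall i j, S i j = S j i) ->
  nab2 S a i j = nab2 S a j i.
Proof.
move=> h; rewrite /nab2 h.
rewrite (@eq_conn a i (S^~ j) (S j)) => [|m]; last exact: h.
by rewrite (@eq_conn a j (S i) (S^~ i)) => [|m]; [ring|exact: h].
Qed.

Lemma der_ip a w v : d a (ip w v) = ip (nab1 w a) v + ip w (nab1 v a).
Proof.
by rewrite /ip der_tr -trD; apply: eq_tr => i j; rewrite nab2_mul.
Qed.

Lemma hess_sym f i j : nab1 (df f) i j = nab1 (df f) j i.
Proof. by rewrite /nab1 /df dC connC. Qed.

(** * Curvature and the Bianchi identities *)

Ltac mx_expand := rewrite ?(mulmxDl, mulmxDr, mulmxBl, mulmxBr, mulNmx, mulmxN,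
  mulmxA, opprK).
Ltac mx_abel := mx_expand; apply/matrixP => ? ?; rewrite !mxE; ring.

Lemma trmxD m p (X Y : 'M[B]_(m, p)) : (X + Y)^T = X^T + Y^T.
Proof. by apply/matrixP => i j; rewrite !mxE. Qed.

Lemma trmxN m p (X : 'M[B]_(m, p)) : (- X)^T = - X^T.
Proof. by apply/matrixP => i j; rewrite !mxE. Qed.

Lemma curvmx_anti k i : curvmx i k = - curvmx k i.
Proof. by rewrite /curvmx; mx_abel. Qed.

Lemma curvE k i j m : curvmx k i j m =
  d k (Gam m i j) - d i (Gam m k j)
  + \sum_a (Gam m k a * Gam a i j - Gam m i a * Gam a k j).
Proof.
rewrite !mxE; congr (_ + _); rewrite -sumrB; apply: eq_bigr => a _.
by rewrite !mxE; ring.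
Qed.

Lemma riemE k i j l : riem k i j l = \sum_m g m l * curvmx k i j m.
Proof. by rewrite /riem mxE; apply: eq_bigr => m _; rewrite mulrC. Qed.

Lemma ip_riem k i j w : ip (riem k i j) w = \sum_m curvmx k i j m * w m.
Proof.
rewrite -[RHS]/(\sum_m curvmx k i j m * w m).
under [RHS]eq_bigr => m _ do rewrite -(tr_gl m w) -trZ.
rewrite /ip /tr exchange_big /=; apply/esym.
under eq_bigr => m _ do rewrite exchange_big /=.
rewrite exchange_big /=; apply: eq_bigr => l _.
rewrite exchange_big /=; apply: eq_bigr => a _.
rewrite riemE mulr_suml mulr_sumr; apply: eq_bigr => m _.
by rewrite (gC m a); ring.
Qed.

(** The symmetry of Gamma removes the terms that act on the first slot; what
    remains is [d_k - gammx k, d_i - gammx i] applied to the column of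
    components of w, that is minus the curvature matrix. *)
Lemma ricci_identity w k i j :
  nab2 (nab1 w) k i j - nab2 (nab1 w) i k j = - ip (riem k i j) w.
Proof.
pose c : 'cV[B]_n := \col_m w m.
pose N a : 'cV[B]_n := map_mx (d a) c - gammx a *m c.
have NE a m : N a m 0 = nab1 w a m.
  by rewrite !mxE /nab1; congr (_ - _); apply: eq_bigr => b _; rewrite !mxE.
have N2E a b m :
    (map_mx (d a) (N b) - gammx a *m N b) m 0 =
    d a (nab1 w b m) - conn a m (nab1 w b).
  rewrite -NE !mxE; congr (_ - _); apply: eq_bigr => l _.
  by rewrite -NE mxE.
have dN a b : map_mx (d a) (N b) = map_mx (d a) (map_mx (d b) c)
    - (map_mx (d a) (gammx b) *m c + gammx b *m map_mx (d a) c).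
  by rewrite (map_mx_derD (hd a)) (map_mx_derN (hd a)) (map_mx_derM (hd a)).
have ddC : map_mx (d k) (map_mx (d i) c) = map_mx (d i) (map_mx (d k) c).
  by apply/matrixP => x y; rewrite !mxE dC.
have : map_mx (d k) (N i) - gammx k *m N i
    - (map_mx (d i) (N k) - gammx i *m N k) = - (curvmx k i *m c).
  by rewrite !dN ddC /N /curvmx; mx_abel.
have subE (X Y : 'cV[B]_n) : (X - Y) j 0 = X j 0 - Y j 0 by rewrite !mxE.
move/(congr1 (fun A : 'cV[B]_n => A j 0)); rewrite subE !N2E.
have -> : (- (curvmx k i *m c)) j 0 = - ip (riem k i j) w.
  rewrite mxE ip_riem; congr (- _); rewrite mxE.
  by apply: eq_bigr => m _; rewrite [c m 0]mxE.
by move=> <-; rewrite /nab2 (connC i k); ring.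
Qed.

Lemma riem_anti12 k i j l : riem i k j l = - riem k i j l.
Proof. by rewrite /riem curvmx_anti mulNmx mxE. Qed.

(** Metricity turns d_k d_i g - d_i d_k g = 0 into the skew-symmetry of
    curvmx k i *m g. *)
Lemma riem_anti34 k i j l : riem k i l j = - riem k i j l.
Proof.
have dd a b : map_mx (d a) (map_mx (d b) g) =
    map_mx (d a) (gammx b) *m g + gammx b *m (gammx a *m g + g *m (gammx a)^T)
    + ((gammx a *m g + g *m (gammx a)^T) *m (gammx b)^T
       + g *m (map_mx (d a) (gammx b))^T).
  rewrite metricity (map_mx_derD (hd a)) !(map_mx_derM (hd a)) metricity.
  by rewrite map_trmx.
have : curvmx k i *m g + (curvmx k i *m g)^T = 0.
  have -> : curvmx k i *m g + (curvmx k i *m g)^T =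
      map_mx (d k) (map_mx (d i) g) - map_mx (d i) (map_mx (d k) g).
    rewrite !dd /curvmx trmx_mul g_sym.
    rewrite !(trmxD, trmxN) !trmx_mul.
    by mx_abel.
  by apply/matrixP => x y; rewrite !mxE dC subrr.
move/(congr1 (fun A : 'M[B]_n => A j l)).
have addE (X Y : 'M[B]_n) : (X + Y) j l = X j l + Y j l by rewrite mxE.
rewrite addE [_^T _ _]mxE [RHS]mxE => /eqP; rewrite addrC addr_eq0 => /eqP E.
exact: E.
Qed.

Lemma curv_bianchi1 k i j m :
  curvmx k i j m + curvmx i j k m + curvmx j k i m = 0.
Proof.
rewrite !curvE (Gam_sym m i j) (Gam_sym m k j) (Gam_sym m i k).
transitivity (\sum_(a < n)
  ((Gam m k a * Gam a i j - Gam m i a * Gam a k j)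
   + (Gam m i a * Gam a j k - Gam m j a * Gam a i k)
   + (Gam m j a * Gam a k i - Gam m k a * Gam a j i))).
  by rewrite !big_split /=; ring.
rewrite big1 // => a _.
by rewrite (Gam_sym a i j) (Gam_sym a k j) (Gam_sym a i k); ring.
Qed.

Lemma riem_bianchi1 k i j l :
  riem k i j l + riem i j k l + riem j k i l = 0.
Proof.
rewrite !riemE -!big_split big1 // => m _ /=.
by rewrite -!mulrDr curv_bianchi1 mulr0.
Qed.

(** A signed sum of the four first Bianchi identities on k, i, j, l equals twice
    the difference of the two sides. *)
Lemma riem_pair_sym : (forall x : B, x + x = 0 -> x = 0) ->
  forall k i j l, riem k i j l = riem j l k i.
Proof.
move=> reg2 k i j l; apply/eqP; rewrite -subr_eq0; apply/eqP; apply: reg2.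
transitivity ((riem k i j l + riem i j k l + riem j k i l)
  + (riem i j l k + riem j l i k + riem l i j k)
  - (riem j l k i + riem l k j i + riem k j l i)
  - (riem l k i j + riem k i l j + riem i l k j)); last first.
  by rewrite !riem_bianchi1; ring.
rewrite (riem_anti34 i j k l) (riem_anti12 j k l i) (riem_anti34 j k i l).
rewrite (riem_anti34 l k j i) (riem_anti34 k i j l) (riem_anti12 l i k j).
by rewrite (riem_anti34 l i j k) (riem_anti34 j l k i); ring.
Qed.

Definition dcurvmx a k i : 'M[B]_n :=
  map_mx (d a) (curvmx k i) - gammx a *m curvmx k i + curvmx k i *m gammx a.

(** The Jacobi identity for the covariant derivatives of rows. *)
Lemma curv_bianchi2 a k i : dcurvmx a k i + dcurvmx k i a + dcurvmx i a k = 0.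
Proof.
have dd b c : map_mx (d b) (map_mx (d c) (gammx a)) =
              map_mx (d c) (map_mx (d b) (gammx a)).
  by apply/matrixP => x y; rewrite !mxE dC.
have ddC b c e : map_mx (d b) (map_mx (d c) (gammx e)) =
              map_mx (d c) (map_mx (d b) (gammx e)).
  by apply/matrixP => x y; rewrite !mxE dC.
have dK b c e : map_mx (d b) (curvmx c e) =
    map_mx (d b) (map_mx (d c) (gammx e)) - map_mx (d b) (map_mx (d e) (gammx c))
    + (map_mx (d b) (gammx e) *m gammx c + gammx e *m map_mx (d b) (gammx c)
       - (map_mx (d b) (gammx c) *m gammx e + gammx c *m map_mx (d b) (gammx e))).
  by rewrite !(map_mx_derD (hd b), map_mx_derN (hd b)) !(map_mx_derM (hd b)).
rewrite /dcurvmx !dK (ddC k a) (ddC i k) (ddC i a) /curvmx.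
by mx_abel.
Qed.

(** Lowering the last index costs nothing, g being parallel: the matrix part
    accounts for the last two slots, and the first two are corrected. *)
Lemma nab4_riem a k i j l :
  nab4 riem a k i j l = (dcurvmx a k i *m g) j l
    - conn a k (fun m => riem m i j l) - conn a i (fun m => riem k m j l).
Proof.
rewrite /nab4 /=.
have -> : d a (riem k i j l) = (map_mx (d a) (curvmx k i *m g)) j l.
  by rewrite mxE.
have -> : conn a j (fun m => riem k i m l) = (gammx a *m (curvmx k i *m g)) j l.
  by rewrite mxE; apply: eq_bigr => m _; rewrite [gammx a j m]mxE.
have -> : conn a l (riem k i j) = ((curvmx k i *m g) *m (gammx a)^T) j l.
  by rewrite mxE; apply: eq_bigr => m _; rewrite [_^T _ _]mxE [gammx a l m]mxE mulrC.
rewrite (map_mx_derM (hd a)) metricity /dcurvmx; mx_expand.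
rewrite !mxE; ring.
Qed.

Lemma riem_bianchi2 a k i j l :
  nab4 riem a k i j l + nab4 riem k i a j l + nab4 riem i a k j l = 0.
Proof.
have := congr1 (fun A : 'M[B]_n => (A *m g) j l) (curv_bianchi2 a k i).
rewrite mul0mx [RHS]mxE.
rewrite (mulmxDl (dcurvmx a k i + dcurvmx k i a)) (mulmxDl (dcurvmx a k i)).
have addE (U V W : 'M[B]_n) : (U + V + W) j l = U j l + V j l + W j l.
  by rewrite !mxE.
rewrite addE => E; rewrite !nab4_riem -[RHS]E.
have anti b c e : conn b c (fun m => riem m e j l) =
                  - conn c b (fun m => riem e m j l).
  by rewrite connC -connN; apply: eq_conn => m; exact: riem_anti12.
by rewrite (anti a k) (anti k i) (anti i a); ring.
Qed.

Lemma nab2_ric a i j : nab2 ric a i j = tr (fun k l => nab4 riem a k i j l).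
Proof. exact: nab2_tr_out. Qed.

Lemma nab4_riem_anti12 a k i j l : nab4 riem a i k j l = - nab4 riem a k i j l.
Proof.
rewrite -nab4N /nab4 riem_anti12 (eq_conn a j (fun m => riem_anti12 k i m l)).
rewrite (eq_conn a l (riem_anti12 k i j)).
rewrite (eq_conn a i (fun m => riem_anti12 k m j l)).
by rewrite (eq_conn a k (fun m => riem_anti12 m i j l)); ring.
Qed.

Lemma nab4_riem_anti34 a k i j l : nab4 riem a k i l j = - nab4 riem a k i j l.
Proof.
rewrite -nab4N /nab4 riem_anti34 (eq_conn a j (fun m => riem_anti34 k i m l)).
rewrite (eq_conn a l (riem_anti34 k i j)).
rewrite (eq_conn a i (fun m => riem_anti34 k m j l)).
by rewrite (eq_conn a k (fun m => riem_anti34 m i j l)); ring.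
Qed.

(** The second Bianchi identity contracted once. *)
Lemma div_riem i a j :
  tr (fun k l => nab4 riem k i a j l) = nab2 ric i a j - nab2 ric a i j.
Proof.
have : tr (fun k l => nab4 riem a k i j l + nab4 riem k i a j l
                      - nab4 riem i k a j l) = 0.
  rewrite -[RHS]tr0; apply: eq_tr => k l.
  by rewrite -[RHS](riem_bianchi2 a k i j l) (nab4_riem_anti12 i k a).
rewrite trB trD -(nab2_ric a i j) -(nab2_ric i a j) => /eqP.
by rewrite subr_eq0 => /eqP <-; rewrite addrAC subrr add0r.
Qed.

(** The second Bianchi identity contracted twice. *)
Lemma div_ric a : d a scal = tr (fun k l => nab2 ric k a l) *+ 2.
Proof.
have : tr (fun i j => tr (fun k l => nab4 riem k i a j l)) =
       - tr (fun k l => nab2 ric k a l).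
  rewrite tr_exchange -trN; apply: eq_tr => k l; rewrite nab2_ric -trN.
  by apply: eq_tr => i j; rewrite nab4_riem_anti34.
rewrite (eq_tr (fun i j => div_riem i a j)).
rewrite (trB (fun i j => nab2 ric i a j) (nab2 ric a)) -(der_tr a ric) -/scal.
move: (d a scal) (tr _) => x y E.
by rewrite mulr2n -[X in _ = _ + X]opprK -E; ring.
Qed.

(** * Schouten and Weyl tensors *)

Section Schouten.
Hypothesis reg2 : forall x : B, x + x = 0 -> x = 0.
Hypothesis reg_n1 : forall x : B, (n%:R - 1) * x = 0 -> x = 0.
Hypothesis reg_n2 : forall x : B, (n%:R - 2) * x = 0 -> x = 0.
Context (P : tens2) (J : B).
Hypothesis scalE : scal = 2 * (n%:R - 1) * J.
Hypothesis ricE : forall i j, ric i j = (n%:R - 2) * P i j + J * g i j.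

Lemma ric_sym i j : ric i j = ric j i.
Proof.
rewrite /ric -tr_sym; apply: eq_tr => k l.
by rewrite (riem_pair_sym reg2) riem_anti12 riem_anti34 opprK.
Qed.

Lemma reg_eq c (x y : B) : (forall x : B, c * x = 0 -> x = 0) ->
  c * x = c * y -> x = y.
Proof.
move=> reg /eqP; rewrite -subr_eq0 -mulrBr => /eqP /reg /eqP.
by rewrite subr_eq0 => /eqP.
Qed.

Lemma reg2_eq (x y : B) : x + x = y + y -> x = y.
Proof.
move=> h; apply/eqP; rewrite -subr_eq0; apply/eqP/reg2.
by transitivity (x + x - (y + y)); [ring | rewrite h subrr].
Qed.

Lemma P_sym i j : P i j = P j i.
Proof.
apply: (reg_eq reg_n2); have := ric_sym i j; rewrite !ricE (gC j i).
by move/addIr.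
Qed.

Lemma tr_P : tr P = J.
Proof.
apply: (reg_eq reg_n2); rewrite -trZ.
transitivity (scal - n%:R * J); last by rewrite scalE; ring.
rewrite /scal (eq_tr ricE) trD [tr (fun _ _ => J * _)]trZ tr_g; ring.
Qed.

Lemma nab2_ricE a i j :
  nab2 ric a i j = (n%:R - 2) * nab2 P a i j + d a J * g i j.
Proof.
rewrite (eq_nab2 _ _ _ ricE) nab2D !nab2Z nab2_g (derB (hd a)).
by rewrite !(der_nat (hd a)); ring.
Qed.

Lemma div_P a : tr (fun k l => nab2 P k a l) = d a J.
Proof.
apply: (reg_eq reg_n2); apply: reg2_eq; have := div_ric a.
rewrite (eq_tr (fun k l => nab2_ricE k a l)) trD trZ tr_gE scalE.
have -> : d a (2 * (n%:R - 1) * J) = 2 * (n%:R - 1) * d a J.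
  rewrite !(derM (hd a)) (derB (hd a)) (der1 (hd a)) !(der_nat (hd a)); ring.
move=> h; transitivity (2 * (n%:R - 1) * d a J - 2 * d a J); last by ring.
by rewrite h; ring.
Qed.

Lemma nab2_P_sym a i j : nab2 P a i j = nab2 P a j i.
Proof. exact/nab2_sym/P_sym. Qed.

Lemma div_P' a : tr (fun k l => nab2 P k l a) = d a J.
Proof. by rewrite -div_P; apply: eq_tr => k l; exact: nab2_P_sym. Qed.

Definition weyl_alg : tens4 := fun k i j l => riem k i j l
  - (g k l * P i j - g k j * P i l + g i j * P k l - g i l * P k j).
Local Notation W := weyl_alg.

Lemma der_g a i j : d a (g i j) = conn a i (fun m => g m j) + conn a j (g i).
Proof. by apply/eqP; rewrite -subr_eq0; apply/eqP/nab2_g. Qed.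

Lemma nab4_weyl a k i j l : nab4 W a k i j l = nab4 riem a k i j l
  - (g k l * nab2 P a i j - g k j * nab2 P a i l + g i j * nab2 P a k l
     - g i l * nab2 P a k j).
Proof.
rewrite /nab4 /nab2 /weyl_alg.
rewrite !(derD (hd a), derN (hd a), derM (hd a)) !(connB, connD, connZ, connZr).
by rewrite !der_g; ring.
Qed.

Lemma weyl_pair_sym k i j l : W k i j l = W j l k i.
Proof.
rewrite /weyl_alg (riem_pair_sym reg2) (gC k l) (gC k j) (gC i j) (gC i l).
by rewrite (P_sym i j) (P_sym i l) (P_sym k l) (P_sym k j); ring.
Qed.

Lemma weyl_anti k i j l : W i k l j = W k i j l.
Proof.
by rewrite /weyl_alg riem_anti12 riem_anti34; ring.
Qed.

Lemma nab4_riem_pair_sym a k i j l : nab4 riem a k i j l = nab4 riem a j l k i.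
Proof. by rewrite (eq_nab4 a k i j l (riem_pair_sym reg2)) /nab4; ring. Qed.

(** The divergence of the Riemann tensor gives n - 2 times the Cotton tensor,
    because Ric = (n - 2) P + J g, plus terms in g and dJ; the subtracted
    product of g and P gives the Cotton tensor once and cancels these terms. *)
Lemma div_weyl j i m : tr (fun k l => nab4 W l k j i m) =
  (n%:R - 3) * (nab2 P m i j - nab2 P i m j).
Proof.
have E k l : nab4 riem l k j i m = - nab4 riem l i m j k.
  by rewrite -nab4_riem_anti34 nab4_riem_pair_sym.
have KN : tr (fun k l => g k m * nab2 P l j i - g k i * nab2 P l j m
      + g j i * nab2 P l k m - g j m * nab2 P l k i) =
    nab2 P m j i - nab2 P i j m + g j i * d m J - g j m * d i J.
  rewrite trB trD trB !trZ !tr_gE.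
  by rewrite -(div_P' m) -(div_P' i) -(tr_sym (fun k l => nab2 P k l m))
     -(tr_sym (fun k l => nab2 P k l i)).
rewrite (eq_tr (fun k l => nab4_weyl l k j i m)) trB KN (eq_tr E) trN.
rewrite (tr_sym (fun k l => nab4 riem k i m j l)) div_riem !nab2_ricE.
rewrite (nab2_P_sym m j i) (nab2_P_sym i j m) (nab2_P_sym i m j).
by rewrite (gC j m) (gC j i); ring.
Qed.

(** * Operators in divergence form *)

(** The covariant derivative of w along v. *)
Definition cov v w : form := fun j => tr (fun m p => v m * nab1 w p j).

Lemma eq_dvg w v : (forall i, w i = v i) -> dvg w = dvg v.
Proof. by move=> h; apply: eq_tr => k i; exact: eq_nab1. Qed.

Lemma dvgD w v : dvg (fun i => w i + v i) = dvg w + dvg v.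
Proof. by rewrite -trD; apply: eq_tr => k i; exact: nab1D. Qed.

Lemma dvgB w v : dvg (fun i => w i - v i) = dvg w - dvg v.
Proof. by rewrite -trB; apply: eq_tr => k i; exact: nab1B. Qed.

Lemma dvgZ f w : dvg (fun i => f * w i) = ip (df f) w + f * dvg w.
Proof. by rewrite -trZ -trD; apply: eq_tr => k i; exact: nab1Z. Qed.

Lemma der_dvg p w : d p (dvg w) = tr (fun k i => nab2 (nab1 w) p k i).
Proof. exact: der_tr. Qed.

Lemma ip_ric_riem p w :
  tr (fun k i => ip (riem k p i) w) = - ip (ric p) w.
Proof.
rewrite /ip tr_exchange -trN; apply: eq_tr => a b; rewrite trZr -mulNr.
by congr (_ * _); rewrite -trN; apply: eq_tr => k i; rewrite riem_anti34.
Qed.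

Lemma nab3_cov v w k i m p : nab3 (fun i m p => v m * nab1 w p i) k i m p =
  nab1 v k m * nab1 w p i + v m * nab2 (nab1 w) k p i.
Proof.
by rewrite /nab3 /nab2 [nab1 v k m]/nab1 (derM (hd k)) !connZ !connZr; ring.
Qed.

(** Exchanging the two covariant derivatives in div(nabla_v w) produces the Ricci
    term; the remaining two terms come from the Leibniz rule. *)
Lemma dvg_cov v w : dvg (cov v w) =
  tr (fun k i => tr (fun m p => nab1 v k m * nab1 w p i))
  + ip v (df (dvg w)) + ip v (fun p => ip (ric p) w).
Proof.
transitivity (tr (fun k i => tr (fun m p => nab1 v k m * nab1 w p i))
  + tr (fun k i => tr (fun m p => v m * nab2 (nab1 w) k p i))).
  rewrite -trD; apply: eq_tr => k i; rewrite nab1_tr -trD.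
  by apply: eq_tr => m p; exact: nab3_cov.
rewrite -addrA; congr (_ + _); rewrite tr_exchange -trD; apply: eq_tr => m p.
rewrite trZ /df der_dvg -mulrDr; congr (_ * _).
rewrite -[X in _ + X]opprK -ip_ric_riem -trB; apply: eq_tr => k i.
by have := ricci_identity w k p i => /eqP; rewrite subr_eq => /eqP ->; ring.
Qed.

Lemma ip_actC T w v : (forall i j, T i j = T j i) ->
  ip w (act T v) = ip v (act T w).
Proof.
move=> Ts; transitivity (tr (fun i j => tr (fun k l => w i * (T k j * v l)))).
  by apply: eq_tr => i j; rewrite trZ.
transitivity (tr (fun i j => tr (fun k l => v i * (T k j * w l)))).
  rewrite tr_exchange -tr_sym; apply: eq_tr => i j; rewrite -tr_sym.
  by apply: eq_tr => k l; rewrite (Ts j k); ring.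
by apply: eq_tr => i j; rewrite trZ.
Qed.

Lemma eq_act S T w v j : (forall i j, S i j = T i j) ->
  (forall i, w i = v i) -> act S w j = act T v j.
Proof. by move=> h1 h2; apply: eq_tr => i k; rewrite h1 h2. Qed.

Lemma actD S T w j :
  act (fun i j => S i j + T i j) w j = act S w j + act T w j.
Proof. by rewrite -trD; apply: eq_tr => i k; rewrite mulrDl. Qed.

Lemma actZ f T w j : act (fun i j => f * T i j) w j = f * act T w j.
Proof. by rewrite -trZ; apply: eq_tr => i k; rewrite mulrA. Qed.

Lemma act_addr T w v j :
  act T (fun i => w i + v i) j = act T w j + act T v j.
Proof. by rewrite -trD; apply: eq_tr => i k; rewrite mulrDr. Qed.

Lemma actZr f T w j : act T (fun i => f * w i) j = f * act T w j.
Proof. by rewrite -trZ; apply: eq_tr => i k; rewrite mulrCA. Qed.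

Lemma eq_ip w w' v v' : (forall i, w i = w' i) -> (forall i, v i = v' i) ->
  ip w v = ip w' v'.
Proof. by move=> h1 h2; apply: eq_tr => i j; rewrite h1 h2. Qed.

Lemma ipDr w v v' : ip w (fun i => v i + v' i) = ip w v + ip w v'.
Proof. by rewrite -trD; apply: eq_tr => i j; rewrite mulrDr. Qed.

Lemma ipZr f w v : ip w (fun i => f * v i) = f * ip w v.
Proof. by rewrite -trZ; apply: eq_tr => i j; rewrite mulrCA. Qed.

Lemma ipZl f w v : ip (fun i => f * w i) v = f * ip w v.
Proof. by rewrite -trZ; apply: eq_tr => i j; rewrite mulrA. Qed.

(** In [dvg_cov] the first term and the Ricci term are symmetric in v and w, so
    only the derivatives of the divergences survive: the classical
    div [v, w] = v(div w) - w(div v). *)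
Lemma dvg_bracket v w : dvg (fun i => cov v w i - cov w v i) =
  ip v (df (dvg w)) - ip w (df (dvg v)).
Proof.
rewrite dvgB !dvg_cov.
have -> : tr (fun k i => tr (fun m p => nab1 w k m * nab1 v p i)) =
          tr (fun k i => tr (fun m p => nab1 v k m * nab1 w p i)).
  rewrite tr_exchange -[RHS]tr_sym; apply: eq_tr => m p.
  by rewrite -[RHS]tr_sym; apply: eq_tr => k i; rewrite mulrC.
have -> : ip w (fun p => ip (ric p) v) = ip v (fun p => ip (ric p) w).
  have E z p : ip (ric p) z = act ric z p.
    by apply: eq_tr => i k; rewrite ric_sym.
  by rewrite !(eq_ip (fun=> erefl) (E _)) ip_actC //; exact: ric_sym.
ring.
Qed.

Lemma eq_dop S T f : (forall i j, S i j = T i j) -> dop S f = dop T f.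
Proof. by move=> h; apply: eq_dvg => j; exact: eq_act. Qed.

Lemma dop_tensD S T f : dop (fun i j => S i j + T i j) f = dop S f + dop T f.
Proof. by rewrite -dvgD; apply: eq_dvg => j; rewrite actD. Qed.

Lemma dop_tensZ c T f : dop (fun i j => c * T i j) f =
  c * dop T f + ip (df c) (act T (df f)).
Proof.
by rewrite addrC -dvgZ; apply: eq_dvg => j; rewrite actZ.
Qed.

Lemma dopD T f1 f2 : dop T (f1 + f2) = dop T f1 + dop T f2.
Proof.
rewrite -dvgD; apply: eq_dvg => j; rewrite -act_addr.
by apply: eq_act => // i; rewrite /df (derD (hd i)).
Qed.

Lemma dopM T f1 f2 : (forall i j, T i j = T j i) -> dop T (f1 * f2) =
  f1 * dop T f2 + f2 * dop T f1 + 2 * ip (df f1) (act T (df f2)).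
Proof.
move=> Ts; transitivity (dvg (fun j => f2 * act T (df f1) j + f1 * act T (df f2) j)).
  apply: eq_dvg => j; rewrite -!actZr -act_addr.
  by apply: eq_act => // i; rewrite /df (derM (hd i)); ring.
by rewrite dvgD !dvgZ (ip_actC (df f2) _ Ts) /dop; ring.
Qed.

Lemma lapE f : lap f = dop (fun i j => g i j) f.
Proof. by apply: eq_dvg => i; rewrite act_g. Qed.

(** Minus the Lie derivative along v of the contravariant tensor T, with its
    indices lowered again. *)
Definition lieT T v : tens2 := fun m j =>
  tr (fun i p => T i j * nab1 v p m) + tr (fun i p => T i m * nab1 v p j)
  - tr (fun a b => v a * nab2 T b m j).

(** With y = T # df one has T # d(v f) = [v, y] + lieT T v # df as the Lie
    derivative obeys the Leibniz rule and commutes with d; then the divergence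
    of [v, y] is given by [dvg_bracket]. *)
Lemma dop_comm T v f : (forall i j, T i j = T j i) ->
  dop T (ip v (df f)) - ip v (df (dop T f)) =
  dop (lieT T v) f - ip (act T (df f)) (df (dvg v)).
Proof.
move=> Ts; set y := act T (df f).
have E j : act T (df (ip v (df f))) j =
    act (lieT T v) (df f) j + (cov v y j - cov y v j).
  have E1 : act T (df (ip v (df f))) j =
      tr (fun i k => T i j * ip (nab1 v k) (df f))
      + tr (fun i k => T i j * ip v (nab1 (df f) k)).
    by rewrite -trD; apply: eq_tr => i k; rewrite /df der_ip mulrDr.
  have E2 : cov v y j =
      tr (fun m p => v m * tr (fun i k => nab2 T p i j * df f k))
      + tr (fun m p => v m * tr (fun i k => T i j * nab1 (df f) p k)).
    rewrite -trD; apply: eq_tr => m p; rewrite -mulrDr -trD nab1_tr.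
    congr (_ * _); apply: eq_tr => i k; rewrite /nab3 /nab2 [nab1 _ p k]/nab1.
    by rewrite (derM (hd p)) connZ !connZr; ring.
  have E3 : act (lieT T v) (df f) j =
      tr (fun m k => tr (fun i p => T i j * nab1 v p m) * df f k)
      + tr (fun m k => tr (fun i p => T i m * nab1 v p j) * df f k)
      - tr (fun m k => tr (fun a b => v a * nab2 T b m j) * df f k).
    by rewrite -trD -trB; apply: eq_tr => m k; rewrite /lieT mulrBl mulrDl.
  rewrite E1 E2 E3.
  have -> : tr (fun m p => v m * tr (fun i k => T i j * nab1 (df f) p k)) =
            tr (fun i k => T i j * ip v (nab1 (df f) k)).
    transitivity (tr (fun m p =>
      tr (fun i k => v m * (T i j * nab1 (df f) p k)))).
      by apply: eq_tr => m p; rewrite trZ.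
    rewrite tr_exchange; apply: eq_tr => i k; rewrite -trZ.
    by apply: eq_tr => m p; rewrite hess_sym; ring.
  have -> : tr (fun m k => tr (fun i p => T i j * nab1 v p m) * df f k) =
            tr (fun i k => T i j * ip (nab1 v k) (df f)).
    transitivity (tr (fun m k =>
      tr (fun i p => T i j * nab1 v p m * df f k))).
      by apply: eq_tr => m k; rewrite trZr.
    rewrite tr_exchange; apply: eq_tr => i p; rewrite -trZ.
    by apply: eq_tr => m k; ring.
  have -> : tr (fun m k => tr (fun i p => T i m * nab1 v p j) * df f k) =
            cov y v j.
    transitivity (tr (fun m k =>
      tr (fun i p => T i m * nab1 v p j * df f k))).
      by apply: eq_tr => m k; rewrite trZr.
    rewrite tr_exchange; apply: eq_tr => i p; rewrite -trZr.
    by apply: eq_tr => m k; rewrite (Ts i m); ring.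
  have -> : tr (fun m k => tr (fun a b => v a * nab2 T b m j) * df f k) =
            tr (fun m p => v m * tr (fun i k => nab2 T p i j * df f k)).
    transitivity (tr (fun m k =>
      tr (fun a b => v a * nab2 T b m j * df f k))).
      by apply: eq_tr => m k; rewrite trZr.
    rewrite tr_exchange; apply: eq_tr => a b; rewrite -trZ.
    by apply: eq_tr => m k; ring.
  ring.
rewrite {1}/dop (eq_dvg E) dvgD dvg_bracket /dop -/y; ring.
Qed.

(** * First conformal variation of the curvature *)

(** The derivation tau is the derivative along a path of metrics in one conformal
    class. *)
Section Conformal.
Context (tau : B -> B) (phi : B).
Hypothesis htau : derivation tau.
Hypothesis tauC : forall i f, tau (d i f) = d i (tau f).
Hypothesis tau_g : forall i j, tau (g i j) = 2 * phi * g i j.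
Local Notation ups := (df phi).
Local Notation hess := (nab1 (df phi)).

Lemma tau_gup i j : tau (gup i j) = - (2 * phi * gup i j).
Proof.
have h : map_mx tau (gup *m g) = 0.
  rewrite gupg; apply/matrixP => a b; rewrite !mxE.
  by rewrite (derMn htau) (der1 htau) mul0rn.
have tg : map_mx tau g = (2 * phi) *: g.
  by apply/matrixP => a b; rewrite !mxE tau_g.
have : map_mx tau (gup *m g) *m gup = 0 by rewrite h mul0mx.
rewrite (map_mx_derM htau) tg mulmxDl -(mulmxA (map_mx _ _)) ggup mulmx1.
rewrite -scalemxAr gupg -scalemxAl mul1mx => /(congr1 (fun A : 'M[B]_n => A i j)).
by rewrite !mxE => /eqP; rewrite addr_eq0 => /eqP.
Qed.

Lemma tau_tr S : tau (tr S) = tr (fun i j => tau (S i j)) - 2 * phi * tr S.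
Proof.
rewrite -trZ -trB /tr (der_sum htau); apply: eq_bigr => i _.
rewrite (der_sum htau); apply: eq_bigr => j _.
by rewrite (derM htau) tau_gup; ring.
Qed.

Definition dconn (k i : 'I_n) w : B := \sum_m tau (Gam m k i) * w m.

Lemma tau_conn k i w : tau (conn k i w) = dconn k i w + conn k i (tau \o w).
Proof.
rewrite /conn (der_sum htau) -big_split; apply: eq_bigr => m _.
by rewrite (derM htau).
Qed.

(** The derivative of the Christoffel symbols is a tensor; differentiating
    metricity determines its sums over two slots, hence, as it is symmetric in
    the other two, the tensor itself (the Koszul argument). *)
Lemma dconnE k i w :
  dconn k i w = ups k * w i + ups i * w k - g k i * ip ups w.
Proof.
pose L k i j := dconn k i (fun m => g m j).
have Ls a b c : L a b c = L b a c.
  by apply: eq_bigr => m _; rewrite Gam_sym.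
have LL a b c : L a b c + L a c b = 2 * ups a * g b c.
  have : tau (d a (g b c)) = d a (2 * phi * g b c) by rewrite tauC tau_g.
  rewrite der_g (derD htau) !tau_conn !(derM (hd a)) (der_nat (hd a)).
  have -> : dconn a c (g b) = L a c b by apply: eq_bigr => m _; rewrite gC.
  rewrite (@eq_conn a b _ (fun m => 2 * phi * g m c)) => [|m]; last exact: tau_g.
  rewrite (@eq_conn a c _ (fun m => 2 * phi * g b m)) => [|m]; last exact: tau_g.
  rewrite !connZ der_g -/(L a b c) => h.
  transitivity (L a b c + 2 * phi * conn a b (fun m => g m c)
    + (L a c b + 2 * phi * conn a c (g b))
    - 2 * phi * (conn a b (fun m => g m c) + conn a c (g b))).
    by ring.
  by rewrite h /df; ring.
have LE a b c : L a b c = ups a * g b c + ups b * g a c - ups c * g a b.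
  apply: reg2_eq.
  transitivity (L a b c + L a c b + (L b a c + L b c a) - (L c a b + L c b a)).
    by rewrite (Ls b a) (Ls c a) (Ls c b); ring.
  by rewrite !LL; ring.
transitivity (tr (fun a b => L k i a * w b)).
  rewrite /dconn; under eq_bigr => m _ do rewrite -(tr_gl m w) -trZ.
  rewrite /tr exchange_big; apply: eq_bigr => a _ /=.
  rewrite exchange_big; apply: eq_bigr => b _ /=.
  rewrite /L /dconn mulr_suml mulr_sumr; apply: eq_bigr => m _.
  by ring.
rewrite (@eq_tr _ (fun a b => ups k * (g i a * w b) + ups i * (g k a * w b)
                              - g k i * (ups a * w b))).
  by rewrite trB trD !trZ !tr_gE.
by move=> a b; rewrite LE; ring.
Qed.

Lemma tau_nab1 w k i : tau (nab1 w k i) = nab1 (tau \o w) k i - dconn k i w.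
Proof. by rewrite /nab1 (derB htau) tauC tau_conn /=; ring. Qed.

Lemma tau_nab2 T k i j : tau (nab2 T k i j) = nab2 (fun i j => tau (T i j)) k i j
  - dconn k i (T^~ j) - dconn k j (T i).
Proof. by rewrite /nab2 (derB htau) (derD htau) tauC !tau_conn /comp; ring. Qed.

Lemma tau_nab3 X l k i j :
  tau (nab3 X l k i j) = nab3 (fun k i j => tau (X k i j)) l k i j
  - dconn l k (fun m => X m i j) - dconn l i (fun m => X k m j)
  - dconn l j (X k i).
Proof. by rewrite /nab3 (derB htau) !(derD htau) tauC !tau_conn /comp; ring. Qed.

Lemma dconnC k i w : dconn k i w = dconn i k w.
Proof. by apply: eq_bigr => m _; rewrite Gam_sym. Qed.

(** The variation of the Ricci identity; the terms that contain tau w cancel by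
    the Ricci identity for tau w. *)
Lemma tau_curv k i j w : \sum_m tau (curvmx k i j m) * w m =
  hess k j * w i - hess i j * w k - g i j * ip (hess k) w
  + g k j * ip (hess i) w.
Proof.
pose E a b := ups a * w b + ups b * w a - g a b * ip ups w.
have h1 a b c : tau (nab2 (nab1 w) a b c) =
    nab2 (nab1 (tau \o w)) a b c - nab2 E a b c
    - dconn a b (fun m => nab1 w m c) - dconn a c (nab1 w b).
  rewrite tau_nab2; congr (_ - _ - _).
  rewrite (@eq_nab2 _ (fun b c => nab1 (tau \o w) b c + - E b c)).
    by rewrite nab2D nab2N.
  by move=> x y; rewrite tau_nab1 dconnE.
have h2 a b c : nab2 E a b c = hess a b * w c + ups b * nab1 w a c
    + (hess a c * w b + ups c * nab1 w a b)
    - g b c * (ip (hess a) w + ip ups (nab1 w a)).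
  rewrite nab2D nab2D nab2N nab2_mul.
  have -> : nab2 (fun i j => ups j * w i) a b c =
            hess a c * w b + ups c * nab1 w a b.
    rewrite (@eq_nab2 _ (fun i j => w i * ups j)) ?nab2_mul; first by ring.
    by move=> x y; rewrite mulrC.
  have -> : nab2 (fun i j => g i j * ip ups w) a b c =
            g b c * (ip (hess a) w + ip ups (nab1 w a)).
    rewrite (@eq_nab2 _ (fun i j => ip ups w * g i j)).
      by rewrite nab2Z nab2_g der_ip; ring.
    by move=> x y; rewrite mulrC.
  by ring.
have h3 : tau (ip (riem k i j) w) = \sum_m tau (curvmx k i j m) * w m
    + ip (riem k i j) (tau \o w).
  rewrite !ip_riem (der_sum htau) -big_split; apply: eq_bigr => m _.
  by rewrite (derM htau).
have := congr1 tau (ricci_identity w k i j).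
rewrite (derN htau) h3 (derB htau) !h1 !h2 (dconnC i k) !dconnE.
have := ricci_identity (tau \o w) k i j.
move=> /eqP; rewrite subr_eq => /eqP ->.
rewrite (hess_sym phi i k) => h; rewrite -[LHS]opprK.
set S := \sum_m _ in h *.
have -> : - S = - (S + ip (riem k i j) (tau \o w)) + ip (riem k i j) (tau \o w).
  by ring.
by rewrite -h; ring.
Qed.

Lemma tau_riem k i j l : tau (riem k i j l) = 2 * phi * riem k i j l
  + (hess k j * g i l - hess i j * g k l - g i j * hess k l + g k j * hess i l).
Proof.
have ipg a b : ip (hess a) (fun m => g m b) = hess a b.
  by rewrite /ip tr_gE.
transitivity (2 * phi * riem k i j l
   + \sum_m tau (curvmx k i j m) * g m l).
  rewrite riemE (der_sum htau) mulr_sumr -big_split; apply: eq_bigr => m _ /=.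
  by rewrite (derM htau) tau_g; ring.
by rewrite (tau_curv k i j (fun m => g m l)) !ipg.
Qed.

Lemma tau_ric i j :
  tau (ric i j) = - ((n%:R - 2) * hess i j) - g i j * lap phi.
Proof.
rewrite /ric tau_tr.
rewrite (@eq_tr _ (fun k l => 2 * phi * riem k i j l
   + (hess k j * g i l - hess i j * g k l - g i j * hess k l
      + g k j * hess i l))) => [|k l]; last exact: tau_riem.
rewrite trD trZ trD trB trB !tr_gE !trZ tr_g -/(lap phi).
by rewrite /lap /dvg; ring.
Qed.

Lemma tau_scal : tau scal = - 2 * phi * scal - 2 * (n%:R - 1) * lap phi.
Proof.
rewrite /scal tau_tr (eq_tr tau_ric) trB trN trZ trZr tr_g.
by rewrite /lap /dvg; ring.
Qed.

Lemma tau_J : tau J = - 2 * phi * J - lap phi.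
Proof.
apply: (reg_eq reg_n1); apply: reg2_eq.
have := tau_scal; rewrite scalE !(derM htau) (derB htau) (der1 htau).
rewrite !(der_nat htau) => h.
transitivity ((0 * (n%:R - 1) + 2 * (0 - 0)) * J + 2 * (n%:R - 1) * tau J).
  by ring.
by rewrite h; ring.
Qed.

Lemma tau_P i j : tau (P i j) = - hess i j.
Proof.
apply: (reg_eq reg_n2).
have := tau_ric i j; rewrite ricE (derD htau) !(derM htau) (derB htau).
rewrite !(der_nat htau) tau_J tau_g => h.
transitivity ((0 - 0) * P i j + (n%:R - 2) * tau (P i j)
   + ((- 2 * phi * J - lap phi) * g i j + J * (2 * phi * g i j))
   + lap phi * g i j); first by ring.
by rewrite h; ring.
Qed.

Lemma tau_weyl k i j l : tau (W k i j l) = 2 * phi * W k i j l.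
Proof.
rewrite /weyl_alg !(derB htau, derD htau, derN htau, derM htau) tau_riem.
by rewrite !tau_P !tau_g; ring.
Qed.

(** * Variation of the Cotton and Bach tensors *)

Definition cotton : tens3 := fun k i j => nab2 P k i j - nab2 P j i k.

Definition bach_alg : tens2 := fun i j =>
  tr (fun k l => nab3 (nab2 P) k l i j) - tr (fun k l => nab3 (nab2 P) l j i k)
  + tr (fun k a => tr (fun l b => P a b * W k i j l)).

Lemma bach_cotton i j : bach_alg i j = tr (fun k l => nab3 cotton l k i j)
  + tr (fun k a => tr (fun l b => P a b * W k i j l)).
Proof.
congr (_ + _); rewrite -(tr_sym (fun k l => nab3 _ k l i j)) -trB.
apply: eq_tr => k l; rewrite -(nab3_rev (nab2 P) l k i j) -nab3B.
by apply: eq_nab3.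
Qed.

(** The third derivatives of phi combine by the Ricci identity into the Riemann
    tensor contracted with dphi, and the variation of the connection acting on
    P supplies the terms in P and g that complete it to the Weyl tensor. *)
Lemma tau_cotton k i j : tau (cotton k i j) = ip (W k j i) ups.
Proof.
have hP a b c : nab2 (fun i j => tau (P i j)) a b c = - nab2 hess a b c.
  by rewrite (@eq_nab2 _ (fun i j => - hess i j)) ?nab2N // => x y; exact: tau_P.
have -> : ip (W k j i) ups = ip (riem k j i) ups - (ups k * P j i
    - g k i * ip (P j) ups + g j i * ip (P k) ups - ups j * P k i).
  rewrite /ip -!trZ.
  transitivity (tr (fun a b => riem k j i a * ups b
     - (P j i * (g k a * ups b) - g k i * (P j a * ups b)
        + g j i * (P k a * ups b) - P k i * (g j a * ups b)))).
    by apply: eq_tr => a b; rewrite /weyl_alg; ring.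
  by rewrite trB trB trD trB !trZ !tr_gE; ring.
have ri := ricci_identity ups k j i.
rewrite /cotton (derB htau) !tau_nab2 !hP !dconnE.
rewrite (nab2_sym k i j (hess_sym phi)) (nab2_sym j i k (hess_sym phi)).
have ipP a : ip ups (P^~ a) = ip (P a) ups.
  by rewrite ipC; apply: eq_tr => x y; rewrite P_sym.
rewrite !ipP (ipC ups (P i)) (P_sym k j) (P_sym i j) (P_sym i k) (gC j k).
have -> : ip (riem k j i) ups =
   - (nab2 hess k j i - nab2 hess j k i) by rewrite ri opprK.
by ring.
Qed.

Lemma tr_cotton j : tr (fun k l => cotton k l j) = 0.
Proof.
by rewrite trB div_P' (tr_sym (nab2 P j)) -(der_tr j P) tr_P subrr.
Qed.

Lemma tr_cotton_skew i : tr (fun k l => cotton k i l) = 0.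
Proof. by rewrite trB tr_sym subrr. Qed.

(** The variation of div(cotton) has three sources: the divergence of the Weyl
    tensor (n - 3 times a Cotton tensor), the Weyl tensor contracted with
    Hess phi, which cancels the variation of P in the last term of B, and the
    three slots of the connection, which contribute n - 2, -1 and -1 times the
    contraction of the Cotton tensor with dphi, and two transposed copies. *)
Lemma tau_bach i j : tau (bach_alg i j) = - 2 * phi * bach_alg i j
  + (n%:R - 4) * ip ups
      (fun m => 2 * nab2 P m i j - nab2 P i j m - nab2 P j i m).
Proof.
set X := ip ups (fun m => cotton m i j).
have D1 : tr (fun k l => dconn l k (fun m => cotton m i j)) = (2 - n%:R) * X.
  rewrite (@eq_tr _ (fun k l => ups l * cotton k i j + ups k * cotton l i j
      - g l k * X)) => [|k l]; last by rewrite dconnE.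
  rewrite trB trD trZr (tr_sym (fun a b => ups a * cotton b i j))
    (tr_sym (fun a b => g a b)) tr_g /X /ip; ring.
have D2 : tr (fun k l => dconn l i (fun m => cotton k m j)) =
    X - ip ups (fun m => cotton i m j).
  rewrite (@eq_tr _ (fun k l => ups l * cotton k i j + ups i * cotton k l j
      - g l i * ip ups (fun m => cotton k m j))) => [|k l]; last by rewrite dconnE.
  rewrite trB trD tr_gE trZ tr_cotton
    (tr_sym (fun a b => ups a * cotton b i j))
    /X /ip; ring.
have D3 : tr (fun k l => dconn l j (cotton k i)) =
    X - ip ups (fun m => cotton j i m).
  rewrite (@eq_tr _ (fun k l => ups l * cotton k i j + ups j * cotton k i l
      - g l j * ip ups (cotton k i))) => [|k l]; last by rewrite dconnE.
  rewrite trB trD tr_gE trZ tr_cotton_skew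
    (tr_sym (fun a b => ups a * cotton b i j))
    /X /ip; ring.
have N4 l k : nab3 (fun k i j => tau (cotton k i j)) l k i j =
   tr (fun m p => nab4 W l k j i m * ups p + W k j i m * hess l p).
  transitivity (nab3 (fun k i j => ip (W k j i) ups) l k i j).
    by apply: eq_nab3 => a b c; exact: tau_cotton.
  rewrite /nab3 der_tr !conn_tr -!trD -trB; apply: eq_tr => m p.
  rewrite /nab2 /nab4 /nab1 (derM (hd l)) !connZ !connZr; ring.
have D4 : tr (fun k l => nab3 (fun k i j => tau (cotton k i j)) l k i j) =
    (n%:R - 3) * ip ups (fun m => nab2 P m i j - nab2 P i m j)
    + tr (fun k l => tr (fun m p => W k j i m * hess l p)).
  rewrite (eq_tr (fun k l => N4 l k)).
  transitivity (tr (fun k l => tr (fun m p => nab4 W l k j i m * ups p))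
     + tr (fun k l => tr (fun m p => W k j i m * hess l p))).
    by rewrite -trD; apply: eq_tr => k l; rewrite trD.
  congr (_ + _); rewrite tr_exchange -trZ -tr_sym; apply: eq_tr => p m.
  by rewrite trZr div_weyl; ring.
have Q : tr (fun k l => tr (fun m p => W k j i m * hess l p)) =
    tr (fun k a => tr (fun l b => hess a b * W k i j l)).
  rewrite tr_exchange; apply: eq_tr => l b; apply: eq_tr => k a.
  by rewrite weyl_pair_sym -weyl_anti (hess_sym phi a b); ring.
have T1 : tau (tr (fun k a => tr (fun l b => P a b * W k i j l))) =
    - 2 * phi * tr (fun k a => tr (fun l b => P a b * W k i j l))
    - tr (fun k a => tr (fun l b => hess a b * W k i j l)).
  rewrite tau_tr.
  transitivity (tr (fun k a => - tr (fun l b => hess a b * W k i j l))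
    - 2 * phi * tr (fun k a => tr (fun l b => P a b * W k i j l))).
    congr (_ - _); apply: eq_tr => k a; rewrite tau_tr -trN -!trZ -trB.
    by apply: eq_tr => l b; rewrite (derM htau) tau_P tau_weyl; ring.
  by rewrite trN; ring.
rewrite bach_cotton (derD htau) T1 tau_tr.
have -> : tr (fun k l => tau (nab3 cotton l k i j)) =
    tr (fun k l => nab3 (fun k i j => tau (cotton k i j)) l k i j)
    - tr (fun k l => dconn l k (fun m => cotton m i j))
    - tr (fun k l => dconn l i (fun m => cotton k m j))
    - tr (fun k l => dconn l j (cotton k i)).
  by rewrite -!trB; apply: eq_tr => k l; exact: tau_nab3.
rewrite D1 D2 D3 D4 Q.
have XE w1 w2 c : ip ups (fun m => c * w1 m + w2 m) =
   c * ip ups w1 + ip ups w2 by rewrite ipDr ipZr.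
pose N a b c : B := nab2 P a b c.
have E1 : ip ups (fun m => nab2 P m i j - nab2 P i m j) =
   ip ups (fun m => N m i j) - ip ups (fun m => N i m j).
  rewrite -[X in _ + X]mulN1r addrC -XE.
  by apply: eq_ip => // m; rewrite /N; ring.
have E2 : X = ip ups (fun m => N m i j) - ip ups (fun m => N j i m).
  rewrite -[X in _ + X]mulN1r addrC -XE.
  by apply: eq_ip => // m; rewrite /N /cotton; ring.
have E3 : ip ups (fun m => cotton i m j) =
    ip ups (fun m => N i m j) - ip ups (fun m => N j i m).
  rewrite -[X in _ + X]mulN1r addrC -XE.
  by apply: eq_ip => // m; rewrite /N /cotton (nab2_P_sym j m i); ring.
have E4 : ip ups (fun m => cotton j i m) =
    ip ups (fun m => N j i m) - ip ups (fun m => N m i j).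
  rewrite -[X in _ + X]mulN1r addrC -XE.
  by apply: eq_ip => // m; rewrite /N /cotton; ring.
have E5 : ip ups (fun m => 2 * nab2 P m i j - nab2 P i j m - nab2 P j i m) =
    2 * ip ups (fun m => N m i j) - ip ups (fun m => N i m j)
    - ip ups (fun m => N j i m).
  transitivity (ip ups (fun m => 2 * N m i j + ((-1) * N i m j
                + (-1) * N j i m))).
    by apply: eq_ip => // m; rewrite /N (nab2_P_sym i m j); ring.
  by rewrite !XE ipZr; ring.
by rewrite E1 E2 E3 E4 E5; ring.
Qed.

Lemma tau_act T w j : tau (act T w j) = act (fun i j => tau (T i j)) w j
  + act T (tau \o w) j - 2 * phi * act T w j.
Proof.
rewrite /act tau_tr -trD; congr (_ - _).
by apply: eq_tr => i k; rewrite (derM htau).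
Qed.

Lemma tau_dvg w : tau (dvg w) =
  dvg (tau \o w) + (n%:R - 2) * ip ups w - 2 * phi * dvg w.
Proof.
rewrite /dvg tau_tr (eq_tr (tau_nab1 w)) trB; congr (_ - _).
have -> : tr (fun k i => dconn k i w) = - ((n%:R - 2) * ip ups w).
  rewrite (eq_tr (fun k i => dconnE k i w)) trB trD trZr tr_g.
  by rewrite -(tr_sym (fun i k => ups i * w k)) tr_sym /ip; ring.
by rewrite opprK.
Qed.

(** The factor n - 4 is n from the volume form less 2 for each of the two indices
    raised, that of df and that of T # df. *)
Lemma tau_dop T f : tau (dop T f) = dop (fun i j => tau (T i j)) f
  + dop T (tau f) + (n%:R - 4) * ip ups (act T (df f)) - 4 * phi * dop T f.
Proof.
rewrite {1}/dop tau_dvg.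
rewrite (@eq_dvg _ (fun j => act (fun i j => tau (T i j)) (df f) j
  + act T (df (tau f)) j - 2 * phi * act T (df f) j)); last first.
  move=> j; rewrite /= tau_act; congr (_ + _ - _).
  by apply: eq_act => // i; rewrite /df /= tauC.
rewrite dvgB dvgD dvgZ.
have -> : ip (df (2 * phi)) (act T (df f)) = 2 * ip ups (act T (df f)).
  rewrite -ipZl; apply: eq_ip => // i.
  by rewrite /df (derM (hd i)) (der_nat (hd i)); ring.
by rewrite /dop; ring.
Qed.

(** * The sixth-order operator *)

Definition sop (c : nat) T (m : B) f : B := c%:R * dop T f + m * f.

(** Twice the skew-adjoint operator f |-> v f + (div v / 2) f. *)
Definition fop v f : B := 2 * ip v (df f) + dvg v * f.

Lemma sop_comm1 c T m f : (forall i j, T i j = T j i) ->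
  sop c T m (phi * f) - phi * sop c T m f =
  fop (fun i => c%:R * act T ups i) f.
Proof.
move=> Ts; rewrite /sop /fop (dopM _ _ Ts) ipZl dvgZ.
have -> : ip (df c%:R) (act T ups) = 0.
  rewrite -(mul0r (ip (fun=> 0) (act T ups))) -ipZl; apply: eq_ip => // i.
  by rewrite /df (der_nat (hd i)) mul0r.
rewrite (ipC (act T ups)) (ip_actC _ _ Ts) /dop; ring.
Qed.

Lemma ip_dfM v f1 f2 :
  ip v (df (f1 * f2)) = f1 * ip v (df f2) + f2 * ip v (df f1).
Proof.
rewrite -!ipZr -ipDr; apply: eq_ip => // i.
by rewrite /df (derM (hd i)); ring.
Qed.

Lemma ip_dfD v f1 f2 : ip v (df (f1 + f2)) = ip v (df f1) + ip v (df f2).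
Proof. by rewrite -ipDr; apply: eq_ip => // i; rewrite /df (derD (hd i)). Qed.

Lemma df_nat c i : df c%:R i = 0.
Proof. exact: der_nat. Qed.

Lemma ip0r w v : (forall i, v i = 0) -> ip w v = 0.
Proof.
by move=> v0; rewrite -[RHS]tr0; apply: eq_tr => i j; rewrite v0 mulr0.
Qed.

Lemma dop_natZ c T f : dop T (c%:R * f) = c%:R * dop T f.
Proof.
rewrite /dop (@eq_dvg _ (fun j => c%:R * act T (df f) j)); last first.
  move=> j; rewrite -actZr; apply: eq_act => // i.
  by rewrite /df (derM (hd i)) (der_nat (hd i)); ring.
by rewrite dvgZ ipC ip0r ?add0r //; exact: df_nat.
Qed.

Lemma dop1 T : dop T 1 = 0.
Proof.
transitivity (dop T 0); last by have := dop_natZ 0 T 0; rewrite !mul0r.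
apply: eq_dvg => j; apply: eq_act => // i.
by rewrite /df (der1 (hd i)) (der0 (hd i)).
Qed.

Lemma dop_tens_natZ c T f : dop (fun i j => c%:R * T i j) f = c%:R * dop T f.
Proof. by rewrite dop_tensZ ipC ip0r ?addr0 //; exact: df_nat. Qed.

(** The terms linear in df from [dop_comm] and from the Leibniz rule for
    (div v) f cancel, so that the commutator is again in divergence form. *)
Lemma sop_comm2 c T m v f : (forall i j, T i j = T j i) ->
  sop c T m (fop v f) - fop v (sop c T m f) =
  2 * c%:R * dop (lieT T v) f
  + (c%:R * dop T (dvg v) - 2 * ip v (df m)) * f.
Proof.
move=> Ts; rewrite /sop /fop.
have -> : dop T (2 * ip v (df f) + dvg v * f) =
   2 * dop T (ip v (df f)) + (dvg v * dop T f + f * dop T (dvg v)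
   + 2 * ip (df (dvg v)) (act T (df f))).
  by rewrite dopD (dop_natZ 2) (dopM _ _ Ts).
rewrite ip_dfD !ip_dfM (@ip0r v (df c%:R)); last exact: df_nat.
have /eqP := dop_comm v f Ts; rewrite subr_eq => /eqP ->.
rewrite (ipC (act T (df f))); ring.
Qed.

Lemma sopD c T m f1 f2 : sop c T m (f1 + f2) = sop c T m f1 + sop c T m f2.
Proof. by rewrite /sop dopD; ring. Qed.

Lemma sop_natZ c T m b f : sop c T m (b%:R * f) = b%:R * sop c T m f.
Proof. by rewrite /sop dop_natZ; ring. Qed.

Lemma sop0 c T m : sop c T m 0 = 0.
Proof. by have := sop_natZ c T m 0 0; rewrite !mul0r. Qed.

Lemma sopN c T m f : sop c T m (- f) = - sop c T m f.
Proof. by apply/eqP; rewrite -subr_eq0 opprK -sopD addNr sop0. Qed.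

Lemma dopN_tens T f : dop (fun i j => - T i j) f = - dop T f.
Proof.
apply/eqP; rewrite -subr_eq0 opprK -dop_tensD.
rewrite (@eq_dop _ (fun i j => 0%:R * T i j)) ?dop_tens_natZ ?mul0r //.
by move=> i j; ring.
Qed.

Definition norm2P : B := tr (fun i k => tr (fun j l => P i j * P k l)).

(** The zeroth-order term of M = P_4 - L^2. *)
Definition potM : B := lap J - J * J - 2 * norm2P.

Local Notation gT := (fun i j => g i j).
Local Notation opL := (sop 1 gT (- 2 * J)).
Local Notation opM := (sop 4 P potM).

Lemma lapM f1 f2 :
  lap (f1 * f2) = f1 * lap f2 + f2 * lap f1 + 2 * ip (df f1) (df f2).
Proof.
rewrite !lapE dopM; last exact: gC.
by congr (_ + 2 * _); apply: eq_ip => // i; rewrite act_g.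
Qed.

Lemma lapD f1 f2 : lap (f1 + f2) = lap f1 + lap f2.
Proof. by rewrite !lapE dopD. Qed.

Lemma lap_natZ c f : lap (c%:R * f) = c%:R * lap f.
Proof. by rewrite !lapE dop_natZ. Qed.

Lemma lapN f : lap (- f) = - lap f.
Proof. by have := sopN 1 gT 0 f; rewrite /sop -!lapE !mul0r !addr0 !mul1r. Qed.

Definition yam f : B := lap f - 2 * J * f.

Definition pan f : B := lap (lap f)
  - dvg (act (fun i j => 4 * J * g i j - 4 * P i j) (df f))
  + (3 * J ^+ 2 - 2 * norm2P - lap J) * f.

Lemma yamE f : yam f = opL f.
Proof. by rewrite /yam /sop lapE; ring. Qed.

(** The terms of P_4 and L^2 that contain J and derivatives of f cancel. *)
Lemma panE f : pan f = opL (opL f) + opM f.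
Proof.
rewrite -!yamE /pan /yam /sop /potM -/(dop _ f).
rewrite (@eq_dop _ (fun i j => J * (4%:R * g i j) + - (4%:R * P i j))); last first.
  by move=> i j; ring.
rewrite dop_tensD dop_tensZ dop_tens_natZ dopN_tens dop_tens_natZ.
have -> : ip (df J) (act (fun i j => 4%:R * g i j) (df f)) =
          4 * ip (df J) (df f).
  by rewrite -ipZr; apply: eq_ip => // i; rewrite actZ act_g.
by rewrite lapD lapN -[2 * J * f]mulrA (lap_natZ 2) lapM -lapE; ring.
Qed.

Lemma lieT_g v m j : lieT gT v m j = nab1 v j m + nab1 v m j.
Proof.
rewrite /lieT !tr_gE (@eq_tr _ (fun _ _ => 0)) ?tr0 ?subr0 // => a b.
by rewrite nab2_g mulr0.
Qed.

(** The double commutator [L,[L,phi]], obtained from [sop_comm1] and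
    [sop_comm2]; the Lie derivative of the metric along dphi is 2 Hess phi. *)
Lemma ad_ad_yam f :
  opL (opL (phi * f)) - 2 * opL (phi * opL f) + phi * opL (opL f) =
  4 * dop hess f + (lap (lap phi) + 4 * ip ups (df J)) * f.
Proof.
pose v i := 1%:R * act gT ups i.
have vE i : v i = ups i by rewrite /v act_g mul1r.
have c1 x : opL (phi * x) = phi * opL x + fop v x.
  have /eqP := sop_comm1 1 (- 2 * J) x gC.
  by rewrite subr_eq => /eqP ->; rewrite addrC.
have -> : opL (opL (phi * f)) = opL (phi * opL f) + opL (fop v f).
  by rewrite (c1 f) sopD.
have /eqP := sop_comm2 1 (- 2 * J) v f gC; rewrite subr_eq => /eqP ->.
rewrite c1.
have -> : dop (lieT gT v) f = 2 * dop hess f.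
  rewrite -(dop_tens_natZ 2); apply: eq_dop => i j; rewrite lieT_g.
  by rewrite !(eq_nab1 _ _ vE) (hess_sym phi j i); ring.
have -> : dvg v = lap phi by exact: eq_dvg.
have -> : ip v (df (- 2 * J)) = - (2 * ip ups (df J)).
  rewrite ip_dfM (@eq_ip _ ups _ (df J) vE) // (@ip0r v (df (- 2))) => [|i].
    by ring.
  by rewrite /df (derN (hd i)) (der_nat (hd i)) oppr0.
rewrite -lapE; ring.
Qed.

(** The full contraction of P with Hess phi. *)
Definition contrPH : B := tr (fun i k => tr (fun j l => P i j * hess k l)).

Lemma tau_norm2P : tau norm2P = - 4 * phi * norm2P - 2 * contrPH.
Proof.
have E : contrPH = tr (fun i k => tr (fun j l => hess i j * P k l)).
  rewrite /contrPH -tr_sym; apply: eq_tr => i k; rewrite -tr_sym.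
  by apply: eq_tr => j l; rewrite mulrC.
rewrite /norm2P tau_tr.
have -> : tr (fun i k => tau (tr (fun j l => P i j * P k l))) =
    tr (fun i k => (-1) * tr (fun j l => hess i j * P k l)
       + (-1) * tr (fun j l => P i j * hess k l)
       + (- 2 * phi) * tr (fun j l => P i j * P k l)).
  apply: eq_tr => i k; rewrite tau_tr -!trZ -!trD -trB; apply: eq_tr => j l.
  by rewrite (derM htau) !tau_P; ring.
by rewrite 2!trD !trZ -E /contrPH; ring.
Qed.

Lemma nab1_act T w a j : nab1 (act T w) a j =
  tr (fun i k => nab2 T a i j * w k) + tr (fun i k => T i j * nab1 w a k).
Proof.
rewrite -trD nab1_tr; apply: eq_tr => i k; rewrite /nab3 /nab2 /nab1.
by rewrite (derM (hd a)) connZ !connZr; ring.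
Qed.

Lemma dopP_phi : dop P phi = ip (df J) ups + contrPH.
Proof.
rewrite /dop /dvg (eq_tr (nab1_act P ups)) trD; congr (_ + _).
  rewrite tr_exchange.
  transitivity (tr (fun i k => d i J * ups k)); last by [].
  apply: eq_tr => i k; rewrite trZr; congr (_ * _).
  exact: div_P.
rewrite tr_exchange /contrPH; apply: eq_tr => i k.
rewrite -tr_sym; apply: eq_tr => j l.
by rewrite P_sym (hess_sym phi l k).
Qed.

Section Dimension6.
Hypothesis nR : n%:R = 6%:R :> B.

Lemma tau_lap f : tau (lap f) = lap (tau f) + 4 * ip ups (df f) - 2 * phi * lap f.
Proof.
rewrite lapE tau_dop (@eq_dop _ (fun i j => 2%:R * (phi * g i j))); last first.
  by move=> i j; rewrite tau_g mulrA.
rewrite dop_tens_natZ dop_tensZ nR.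
have -> x : ip ups (act gT (df x)) = ip ups (df x).
  by apply: eq_ip => // i; rewrite act_g.
by rewrite -!lapE; ring.
Qed.

Lemma tau_yam f : tau (opL f) =
  opL (tau f) - 4 * (phi * opL f) + 2 * opL (phi * f).
Proof.
rewrite -!yamE /yam lapM (derB htau) !(derM htau) tau_lap tau_J.
by rewrite (der_nat htau 2); ring.
Qed.

Lemma tau_potM : tau potM = - 4 * phi * potM
  + 4 * contrPH - lap (lap phi).
Proof.
rewrite /potM !(derB htau) !(derM htau) (der_nat htau 2) tau_norm2P tau_lap.
have -> : tau J = - 2 * phi * J - lap phi by exact: tau_J.
have -> : lap (- 2 * phi * J - lap phi) =
    - 2 * (phi * lap J + J * lap phi + 2 * ip ups (df J)) - lap (lap phi).
  rewrite -lapM.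
  have -> : - 2 * phi * J - lap phi = - (2 * (phi * J) + lap phi) by ring.
  by rewrite lapN lapD (lap_natZ 2); ring.
by ring.
Qed.

(** As tau P = -Hess phi, the operator 4 div(P # d) varies by -4 div(Hess phi # d),
    the second-order part of -[L,[L,phi]]; the potentials match as well.
    Equivalently, P_4 = L^2 + M is conformally covariant. *)
Lemma tau_M f : tau (opM f) = opM (tau f) - 5 * (phi * opM f) + opM (phi * f)
  - (opL (opL (phi * f)) - 2 * opL (phi * opL f) + phi * opL (opL f)).
Proof.
rewrite ad_ad_yam {1 2 3 4}/sop (derD htau) !(derM htau) (der_nat htau 4).
rewrite tau_dop nR tau_potM (eq_dop _ tau_P) dopN_tens (dopM _ _ P_sym).
by rewrite dopP_phi (ipC (df J)); ring.
Qed.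

Definition opK f : B := 2 * (yam (pan f) + pan (yam f)) - 3 * yam (yam (yam f)).

(** The definition contains 4 L^3 - 3 L^3. *)
Lemma opKE f : opK f =
  opL (opL (opL f)) + 2 * (opL (opM f) + opM (opL f)).
Proof. by rewrite /opK !panE !yamE sopD; ring. Qed.

(** The fields along which [M, phi] and [L, phi] differentiate. *)
Definition Kvec : form := fun i => 4%:R * act P ups i.
Definition Kgrad : form := fun i => 1%:R * act gT ups i.

Definition Kpot : B :=
  2 * (1%:R * dop gT (dvg Kvec) - 2 * ip Kvec (df (- 2 * J)))
  + 4 * (4%:R * dop P (dvg Kgrad) - 2 * ip Kgrad (df potM)).

(** After expansion the two sides are combinations of the words in L, M and phi
    applied to f; the words of degree three in L cancel. *)
Lemma tau_K_comm f : tau f = 0 -> tau (opK f) + 6 * phi * opK f =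
  2 * (opL (fop Kvec f) - fop Kvec (opL f))
  + 4 * (opM (fop Kgrad f) - fop Kgrad (opM f)).
Proof.
move=> tu.
have c4 x : fop Kvec x = opM (phi * x) - phi * opM x.
  by rewrite -(sop_comm1 4 potM x P_sym).
have c1 x : fop Kgrad x = opL (phi * x) - phi * opL x.
  by rewrite -(sop_comm1 1 (- 2 * J) x gC).
rewrite !c4 !c1 opKE.
have LD x y : opL (x + y) = opL x + opL y by exact: sopD.
have LN x : opL (- x) = - opL x by exact: sopN.
have MD x y : opM (x + y) = opM x + opM y by exact: sopD.
have MN x : opM (- x) = - opM x by exact: sopN.
have L2 x : opL (2 * x) = 2 * opL x by exact: (sop_natZ _ _ _ 2).
have L4 x : opL (4 * x) = 4 * opL x by exact: (sop_natZ _ _ _ 4).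
have L5 x : opL (5 * x) = 5 * opL x by exact: (sop_natZ _ _ _ 5).
have M2 x : opM (2 * x) = 2 * opM x by exact: (sop_natZ _ _ _ 2).
have M4 x : opM (4 * x) = 4 * opM x by exact: (sop_natZ _ _ _ 4).
have tL x : tau (opL x) = opL (tau x) - 4 * (phi * opL x) + 2 * opL (phi * x).
  exact: tau_yam.
have tM x : tau (opM x) = opM (tau x) - 5 * (phi * opM x) + opM (phi * x)
  - (opL (opL (phi * x)) - 2 * opL (phi * opL x) + phi * opL (opL x)).
  exact: tau_M.
have L0 : opL 0 = 0 by exact: sop0.
have M0 : opM 0 = 0 by exact: sop0.
rewrite (derD htau) (derM htau) (der_nat htau 2) (derD htau).
move: (opL) (opM) LD LN MD MN L2 L4 L5 M2 M4 tL tM L0 M0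
  => L M LD LN MD MN L2 L4 L5 M2 M4 tL tM L0 M0.
rewrite !(tL, tM) tu !(LD, LN, MD, MN, L2, L4, L5, M2, M4, L0, M0).
by ring.
Qed.

Lemma tau_K f : tau f = 0 -> tau (opK f) + 6 * phi * opK f =
  4 * dop (lieT gT Kvec) f + 32 * dop (lieT P Kgrad) f + Kpot * f.
Proof.
move=> tf; rewrite (tau_K_comm tf).
rewrite (sop_comm2 1 (- 2 * J) Kvec f gC) (sop_comm2 4 potM Kgrad f P_sym).
by rewrite /Kpot; ring.
Qed.

(** The non-constant part. *)
Definition opK0 f : B := opK f - opK 1 * f.

(** The case f = 1 of [tau_K] identifies the potential with the variation of
    opK 1. *)
Lemma tau_K0 f : tau f = 0 -> tau (opK0 f) + 6 * phi * opK0 f =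
  4 * dop (lieT gT Kvec) f + 32 * dop (lieT P Kgrad) f.
Proof.
move=> tf; have := tau_K (der1 htau); rewrite !dop1 => K1.
transitivity (tau (opK f) + 6 * phi * opK f
  - (tau (opK 1) + 6 * phi * opK 1) * f).
  by rewrite /opK0 (derB htau) (derM htau) tf; ring.
by rewrite K1 (tau_K tf); ring.
Qed.

Lemma tau_dop6 T f : tau f = 0 -> tau (dop T f) + 6 * phi * dop T f =
  dop (fun i j => tau (T i j) + 2%:R * (phi * T i j)) f.
Proof.
move=> tf; rewrite dop_tensD dop_tens_natZ dop_tensZ tau_dop tf nR.
have -> : dop T 0 = 0 by have := dop_natZ 0 T 0; rewrite !mul0r.
by ring.
Qed.

Definition schouten2 : tens2 := fun i j => tr (fun k l => P i k * P l j).

Definition P6_alg f : B :=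
  opK0 f + 48 * dop schouten2 f + 8 * dop bach_alg f.

Lemma tau_schouten2 i j : tau (schouten2 i j) + 2 * (phi * schouten2 i j) =
  - (tr (fun k l => P k j * hess l i) + tr (fun k l => P k i * hess l j)).
Proof.
rewrite /schouten2 tau_tr.
have -> : tr (fun k l => tau (P i k * P l j)) =
  - (tr (fun k l => P k j * hess l i) + tr (fun k l => P k i * hess l j)).
  rewrite -(tr_sym (fun k l => P k j * hess l i)) -trD -trN.
  apply: eq_tr => k l; rewrite (derM htau) !tau_P (P_sym i k).
  by rewrite (hess_sym phi i k); ring.
by ring.
Qed.

(** Let Z, S and Q denote the contractions of nabla P with dphi in a slot of P,
    of nabla P with dphi in the slot of the derivative, and of P with Hess phi;
    S is symmetric. The tensors that must cancel are each the sum of a tensor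
    and its transpose: 16 (Z + Q) + 32 Q - 16 S from [tau_K0], -48 Q from P^2
    and 16 (S - Z) from B. *)
Theorem tau_P6 f : tau f = 0 -> tau (P6_alg f) + 6 * phi * P6_alg f = 0.
Proof.
move=> tf; pose v0 := act P ups.
pose Q m j := tr (fun i p => P i j * hess p m).
pose S m j := tr (fun a b => ups a * nab2 P b m j).
pose Z m j := tr (fun i k => nab2 P m i j * ups k).
have v0E p m : nab1 Kvec p m = 4 * (Z p m + Q p m).
  transitivity (nab1 (fun i => 4%:R * v0 i) p m); first by [].
  rewrite nab1Z (der_nat (hd p)) mul0r add0r nab1_act; congr (_ * (_ + _)).
  by apply: eq_tr => i k; rewrite (hess_sym phi p k).
have A m j : lieT gT Kvec m j = 4 * (Z j m + Q j m + (Z m j + Q m j)).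
  by rewrite lieT_g !v0E; ring.
have kE i : Kgrad i = ups i by rewrite /Kgrad act_g mul1r.
have C m j : lieT P Kgrad m j = Q m j + Q j m - S m j.
  rewrite /lieT; congr (_ + _ - _); apply: eq_tr => a b;
    by rewrite ?(eq_nab1 _ _ kE) ?kE.
have D i j : tau (schouten2 i j) + 2 * (phi * schouten2 i j) =
    - (Q i j + Q j i) by exact: tau_schouten2.
have E i j : tau (bach_alg i j) + 2 * (phi * bach_alg i j) =
    2 * (2 * S i j - Z i j - Z j i).
  rewrite tau_bach nR.
  have -> : ip ups (fun m => 2 * nab2 P m i j - nab2 P i j m - nab2 P j i m) =
      2 * S i j - Z i j - Z j i.
    rewrite /S /Z -(tr_sym (fun p k => nab2 P i p j * ups k)).
    rewrite -(tr_sym (fun p k => nab2 P j p i * ups k)) -trZ.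
    have tB3 T1 T2 T3 : tr T1 - tr T2 - tr T3 =
       tr (fun a b => T1 a b - T2 a b - T3 a b) by rewrite !trB.
    rewrite tB3; apply: eq_tr => a b.
    by rewrite (nab2_P_sym i j b) (nab2_P_sym j i b); ring.
  by ring.
transitivity (tau (opK0 f) + 6 * phi * opK0 f
  + 48 * (tau (dop schouten2 f) + 6 * phi * dop schouten2 f)
  + 8 * (tau (dop bach_alg f) + 6 * phi * dop bach_alg f)).
  rewrite /P6_alg !(derD htau) !(derM htau) (der_nat htau 48) (der_nat htau 8).
  by ring.
rewrite (tau_K0 tf) !(tau_dop6 _ tf) -(dop_tens_natZ 4) -(dop_tens_natZ 32).
rewrite -(dop_tens_natZ 48) -(dop_tens_natZ 8) -!dop_tensD.
rewrite (@eq_dop _ (fun i j => 0%:R * g i j)) ?dop_tens_natZ ?mul0r //.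
by move=> i j; rewrite A C D E; ring.
Qed.

End Dimension6.
End Conformal.
End Schouten.
End Metric.
End Tensors.

(** * The Levi-Civita connection *)

Section LeviCivita.
Context {B : comPzRingType} {n : nat}.
Context (d : 'I_n -> B -> B) (g gup : 'M[B]_n) (half : B).
Hypothesis half2 : half + half = 1.
Hypothesis g_sym : g^T = g.
Hypothesis gup_sym : gup^T = gup.
Hypothesis gupg : gup *m g = 1%:M.

Definition levi_civita (k i j : 'I_n) : B :=
  half * \sum_m gup k m * (d i (g m j) + d j (g m i) - d m (g i j)).

Lemma levi_civita_sym k i j : levi_civita k i j = levi_civita k j i.
Proof.
have gC a b : g a b = g b a by rewrite -{1}g_sym mxE.
congr (_ * _); apply: eq_bigr => m _; congr (_ * _).
by rewrite (gC i j); ring.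
Qed.

Lemma levi_civita_metric k :
  map_mx (d k) g = gammx levi_civita k *m g + g *m (gammx levi_civita k)^T.
Proof.
have gC a b : g a b = g b a by rewrite -{1}g_sym mxE.
have gupC a b : gup a b = gup b a by rewrite -{1}gup_sym mxE.
have low i j : \sum_m levi_civita m k i * g m j =
    half * (d k (g j i) + d i (g j k) - d j (g k i)).
  transitivity (half * \sum_l (d k (g l i) + d i (g l k) - d l (g k i))
                       * (gup *m g) l j); last first.
    rewrite gupg (bigD1 j) //= big1 ?addr0; first by rewrite mxE eqxx mulr1.
    by move=> l /negPf; rewrite mxE => ->; rewrite mulr0.
  rewrite mulr_sumr; under [RHS]eq_bigr => l _ do rewrite mxE !mulr_sumr.
  rewrite exchange_big; apply: eq_bigr => m _ /=.
  rewrite /levi_civita -mulrA mulr_suml mulr_sumr; apply: eq_bigr => l _.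
  by rewrite (gupC l m); ring.
apply/matrixP => i j; rewrite !mxE.
transitivity (\sum_m levi_civita m k i * g m j + \sum_m levi_civita m k j * g m i).
  rewrite !low (gC j i) (gC j k) (gC i k) (gC k i) (gC k j).
  by rewrite -[LHS]mul1r -half2; ring.
by congr (_ + _); apply: eq_bigr => m _; rewrite !mxE // mulrC gC.
Qed.

End LeviCivita.

(** * Symmetry of mixed derivatives *)

Section Schwarz.
Context {R : realType} {V : normedModType R}.
Implicit Types (f : V -> R) (x v w : V).

Lemma is_derive_line f x v (s : R) : derivable f (s *: v + x) v ->
  is_derive s 1 (fun t : R => f (t *: v + x)) ('D_v f (s *: v + x)).
Proof.
move=> df; have E : (fun h : R => h^-1 *:
    (((fun t : R => f (t *: v + x)) \o shift s) (h *: 1) - f (s *: v + x))) =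
    (fun h => h^-1 *: ((f \o shift (s *: v + x)) (h *: v) - f (s *: v + x))).
  apply/funext => h; congr (_ *: (f _ - _)).
  by rewrite /= [h *: 1]mulr1 scalerDl addrA.
by split; rewrite /derivable /derive E.
Qed.

Lemma open_norm_ball (O : set V) x : open O -> O x ->
  exists2 r : R, 0 < r & forall y, `|y| < r -> O (y + x).
Proof.
move=> oO Ox; have /nbhs_ballP[r /= r0 rO] : nbhs x O by apply: open_nbhs_nbhs.
exists r => // y yr; apply: rO; rewrite -ball_normE /= opprD addrCA subrr addr0.
by rewrite normrN.
Qed.

Lemma diff_estimate f x (e : R) : differentiable f x -> 0 < e ->
  exists2 r : R, 0 < r &
  forall y, `|y| < r -> `|f (y + x) - f x - 'd f x y| <= e * `|y|.
Proof.
move=> df e0; have /eqaddoP/(_ _ e0) := diff_locally df.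
move=> /nbhs_ballP[r /= r0 h]; exists r => // y yr.
have /h : ball 0 r y by rewrite -ball_normE /= sub0r normrN.
by rewrite /= opprD addrA.
Qed.

(** By the mean value theorem in the direction v, the second difference is h
    times an increment of D_v f between two points at distance O(h) of x, and
    there D_v f is given by its differential at x up to o(h). *)
Lemma mixed_difference (O : set V) f x v w (e : R) : open O -> O x -> 0 < e ->
  (forall y, O y -> differentiable f y) -> differentiable ('D_v f) x ->
  exists2 r : R, 0 < r & forall h : R, 0 < h < r ->
  `|f (h *: v + (h *: w + x)) - f (h *: v + x) - f (h *: w + x) + f x
    - h ^+ 2 * 'D_w ('D_v f) x| <= e * h ^+ 2.
Proof.
move=> oO Ox e0 df dG; have [r1 r10 rO] := open_norm_ball oO Ox.
pose C := `|v| + `|w| + 1.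
have C0 : 0 < C by rewrite /C ltr_wpDl // addr_ge0.
(* both points of the increment are within h * C of x *)
have e'0 : 0 < e / (2 * C) by rewrite divr_gt0 // mulr_gt0.
have [r2 r20 rG] := diff_estimate dG e'0.
exists (Num.min r1 r2 / C) => [|h /andP[h0 hr]].
  by rewrite divr_gt0 // lt_min r10.
have hC : h * C < Num.min r1 r2 by rewrite -ltr_pdivlMr.
have small s : 0 <= s <= h ->
    `|s *: v + h *: w| <= h * C /\ `|s *: v| <= h * C.
  move=> /andP[s0 sh].
  have sv : `|s *: v| <= h * `|v|.
    by rewrite normrZ ger0_norm // ler_wpM2r.
  have hw : `|h *: w| = h * `|w| by rewrite normrZ gtr0_norm.
  rewrite /C !mulrDr mulr1; split.
    apply: le_trans (ler_normD _ _) _; rewrite hw -addrA lerD //.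
    by rewrite lerDl ltW.
  by apply: le_trans sv _; rewrite -addrA lerDl addr_ge0 ?mulr_ge0 ?normr_ge0 ?ltW.
have inO s : 0 <= s <= h -> O (s *: v + (h *: w + x)) /\ O (s *: v + x).
  have hr1 : h * C < r1 by apply: lt_le_trans hC _; rewrite ge_min lexx.
  move=> /small[n1 n2]; rewrite addrA.
  by split; apply: rO; [apply: le_lt_trans n1 _ | apply: le_lt_trans n2 _].
pose F (s : R) : R := f (s *: v + (h *: w + x)) - f (s *: v + x).
pose dF (s : R) : R := 'D_v f (s *: v + (h *: w + x)) - 'D_v f (s *: v + x).
have dFP s : 0 <= s <= h -> is_derive s 1 F (dF s).
  move=> /inO[p1 p2]; apply: is_deriveB; apply: is_derive_line;
    exact/diff_derivable/df.
have [||c /[!in_itv]/= /andP[c0 ch] Fc] := @MVT R F dF 0 h h0.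
- move=> s /[!in_itv]/= /andP[s0 sh].
  by apply: dFP; rewrite !ltW.
- apply: derivable_within_continuous => s /[!in_itv]/= sh.
  by have [] := dFP _ sh.
have ch' : 0 <= c <= h by rewrite !ltW.
have [n1 n2] := small c ch'.
have lt2 (z : V) : `|z| <= h * C -> `|z| < r2.
  by move=> zh; apply: le_lt_trans zh (lt_le_trans hC _); rewrite ge_min lexx orbT.
have g1 := rG _ (lt2 _ n1); have g2 := rG _ (lt2 _ n2).
have Q : f (h *: v + (h *: w + x)) - f (h *: v + x) - f (h *: w + x) + f x
    = h * dF c.
  have -> : h * dF c = dF c * (h - 0) by rewrite subr0 mulrC.
  by rewrite -Fc /F !scale0r !add0r; ring.
rewrite Q expr2 -mulrA -mulrBr normrM gtr0_norm // mulrCA ler_pM2l //.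
have -> : dF c - h * 'D_w ('D_v f) x =
    ('D_v f (c *: v + h *: w + x) - 'D_v f x - 'd ('D_v f) x (c *: v + h *: w))
    - ('D_v f (c *: v + x) - 'D_v f x - 'd ('D_v f) x (c *: v)).
  have -> : 'd ('D_v f) x (c *: v + h *: w) =
      'd ('D_v f) x (c *: v) + h * 'd ('D_v f) x w by rewrite linearD !linearZ.
  by rewrite deriveE // /dF addrA; ring.
apply: le_trans (ler_normB _ _) _.
apply: (@le_trans _ _ (e / (2 * C) * (h * C) + e / (2 * C) * (h * C))).
  by apply: lerD; [apply: le_trans g1 _|apply: le_trans g2 _];
    rewrite ler_pM2l.
by rewrite le_eqVlt; apply/orP; left; apply/eqP; field; rewrite gt_eqF.
Qed.

(** The second difference of [mixed_difference] is symmetric in v and w. *)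
Lemma derive_comm (O : set V) f x v w : open O -> O x ->
  (forall y, O y -> differentiable f y) ->
  differentiable ('D_v f) x -> differentiable ('D_w f) x ->
  'D_w ('D_v f) x = 'D_v ('D_w f) x.
Proof.
move=> oO Ox df dv dw; apply/eqP; rewrite -subr_eq0 -normr_le0.
apply/ler_addgt0Pr => e e0; rewrite add0r.
have e2 : 0 < e / 2 by rewrite divr_gt0.
have [r1 r10 H1] := mixed_difference w oO Ox e2 df dv.
have [r2 r20 H2] := mixed_difference v oO Ox e2 df dw.
pose h := Num.min r1 r2 / 2.
have m0 : 0 < Num.min r1 r2 by rewrite lt_min r10.
have h0 : 0 < h by rewrite divr_gt0.
have hm : h < Num.min r1 r2 by rewrite /h; lra.
have := H1 h; rewrite h0 (lt_le_trans hm) ?ge_min ?lexx // => /(_ isT) h1.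
have := H2 h; rewrite h0 (lt_le_trans hm) ?ge_min ?lexx ?orbT // => /(_ isT) h2.
rewrite -(@ler_pM2l _ (h ^+ 2)) ?exprn_gt0 //.
move: h1 h2; move: ('D_w ('D_v f) x) ('D_v ('D_w f) x) => a b h1 h2.
have hh : `|h ^+ 2| = h ^+ 2 by apply/gtr0_norm/exprn_gt0.
rewrite -{1}hh -normrM mulrBr.
set Q := f _ - _ - _ + _ in h1.
have Q2 : f (h *: w + (h *: v + x)) - f (h *: w + x) - f (h *: v + x) + f x = Q.
  by rewrite /Q addrCA; ring.
rewrite Q2 in h2.
have -> : h ^+ 2 * a - h ^+ 2 * b = (Q - h ^+ 2 * b) - (Q - h ^+ 2 * a) by ring.
apply: le_trans (ler_normB _ _) _; apply: le_trans (lerD h2 h1) _.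
by rewrite le_eqVlt; apply/orP; left; apply/eqP; field.
Qed.

End Schwarz.

(** * Smooth functions on an open set *)

Section Smooth.
Context {R : realType} {V : normedModType R}.
Implicit Types (f g : V -> R) (x : V).

Lemma near_eq_differentiable f g x :
  {near x, f =1 g} -> differentiable f x -> differentiable g x.
Proof.
move=> fg df; have fgx : f x = g x by exact: nbhs_singleton fg.
have H : g \o shift x = cst (g x) + 'd f x +o_ 0 id.
  apply/eqaddoP => e e0; have /eqaddoP/(_ _ e0) := diff_locally df.
  apply: filter_app; move/nbhs_ballP: fg => [r /= r0 fg].
  apply/nbhs_ballP; exists r => // y; rewrite -ball_normE /= sub0r normrN => yr.
  have E : f (y + x) = g (y + x).
    apply: fg; rewrite -ball_normE /= opprD addrCA subrr addr0.
    by rewrite normrN.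
  by rewrite !fctE /= E fgx.
have dgf := diff_unique (diff_continuous df) H.
by apply/diff_locallyP; rewrite dgf; split => //; exact: diff_continuous.
Qed.

Context {I : Type} (v : I -> V) (O : set V).
Hypothesis oO : open O.

Definition pd (i : I) f : V -> R := fun x => 'D_(v i) f x.

(** Recursion on the order, rather than a condition on all sequences of
    directions, makes the Leibniz and chain rules direct inductions. *)
Fixpoint Cn (k : nat) f : Prop :=
  (forall x, O x -> differentiable f x) /\
  (if k is k'.+1 then forall i, Cn k' (pd i f) else True).

Definition smooth f := forall k, Cn k f.

Lemma near_in f g x : (forall y, O y -> f y = g y) -> O x -> {near x, f =1 g}.
Proof. by move=> fg Ox; apply: filterS (open_nbhs_nbhs (conj oO Ox)). Qed.

Lemma eq_pd i f g : (forall x, O x -> f x = g x) ->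
  forall x, O x -> pd i f x = pd i g x.
Proof. by move=> fg x Ox; apply: near_eq_derive; exact: near_in fg Ox. Qed.

Lemma eq_Cn k f g : (forall x, O x -> f x = g x) -> Cn k f -> Cn k g.
Proof.
elim: k f g => [|k IH] f g fg [df Cf]; split => //.
- by move=> x Ox; apply: near_eq_differentiable (df _ Ox); exact: near_in fg Ox.
- by move=> x Ox; apply: near_eq_differentiable (df _ Ox); exact: near_in fg Ox.
by move=> i; apply: IH (Cf i); exact: eq_pd.
Qed.

Lemma eq_smooth f g : (forall x, O x -> f x = g x) -> smooth f -> smooth g.
Proof. by move=> fg sf k; exact: eq_Cn (sf k). Qed.

Lemma Cn_diff k f x : Cn k f -> O x -> differentiable f x.
Proof. by case: k => [|k] [df _]; exact: df. Qed.

Lemma CnW k f : Cn k.+1 f -> Cn k f.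
Proof. by elim: k f => [|k IH] f [df Cf]; split => // i; exact: IH. Qed.

Lemma Cn_derivable k f x w : Cn k f -> O x -> derivable f x w.
Proof. by move=> Cf Ox; exact/diff_derivable/(Cn_diff Cf). Qed.

Lemma CnD k f g : Cn k f -> Cn k g -> Cn k (fun x => f x + g x).
Proof.
elim: k f g => [|k IH] f g Cf Cg; split => //.
- by move=> x Ox; apply: differentiableD; [exact: Cn_diff Cf _|exact: Cn_diff Cg _].
- by move=> x Ox; apply: differentiableD; [exact: Cn_diff Cf _|exact: Cn_diff Cg _].
move=> i; apply: eq_Cn (IH _ _ (Cf.2 i) (Cg.2 i)) => x Ox.
by rewrite [RHS]deriveD //; [exact: Cn_derivable Cf _|exact: Cn_derivable Cg _].
Qed.

Lemma CnM k f g : Cn k f -> Cn k g -> Cn k (fun x => f x * g x).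
Proof.
elim: k f g => [|k IH] f g Cf Cg; split => //.
- by move=> x Ox; apply: differentiableM; [exact: Cn_diff Cf _|exact: Cn_diff Cg _].
- by move=> x Ox; apply: differentiableM; [exact: Cn_diff Cf _|exact: Cn_diff Cg _].
move=> i; apply: eq_Cn (CnD (IH _ _ (CnW Cf) (Cg.2 i)) (IH _ _ (CnW Cg) (Cf.2 i))).
move=> x Ox.
by rewrite [RHS]deriveM //; [exact: Cn_derivable Cf _|exact: Cn_derivable Cg _].
Qed.

Lemma smooth_cst c : smooth (fun=> c).
Proof.
move=> k; elim: k c => [|k IH] c; split => //;
  try by move=> x _; exact: differentiable_cst.
by move=> i; apply: eq_Cn (IH 0) => x _; rewrite /pd [RHS]derive_cst.
Qed.

Lemma smoothD f g : smooth f -> smooth g -> smooth (fun x => f x + g x).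
Proof. by move=> sf sg k; exact: CnD. Qed.

Lemma smoothM f g : smooth f -> smooth g -> smooth (fun x => f x * g x).
Proof. by move=> sf sg k; exact: CnM. Qed.

Lemma smoothN f : smooth f -> smooth (fun x => - f x).
Proof.
move=> sf; apply: eq_smooth (smoothM (smooth_cst (-1)) sf) => x _.
by rewrite mulN1r.
Qed.

Lemma smooth_pd i f : smooth f -> smooth (pd i f).
Proof. by move=> sf k; exact: (sf k.+1).2. Qed.

Lemma smooth_sum (J : Type) (s : seq J) (P : pred J) (F : J -> V -> R) :
  (forall j, P j -> smooth (F j)) -> smooth (fun x => \sum_(j <- s | P j) F j x).
Proof.
move=> sF; elim: s => [|j s IH].
  by apply: eq_smooth (smooth_cst 0) => x _; rewrite big_nil.
case Pj: (P j).
  apply: eq_smooth (smoothD (sF _ Pj) IH) => x _.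
  by rewrite big_cons Pj.
by apply: eq_smooth IH => x _; rewrite big_cons Pj.
Qed.

Lemma smooth_prod (J : Type) (s : seq J) (P : pred J) (F : J -> V -> R) :
  (forall j, P j -> smooth (F j)) -> smooth (fun x => \prod_(j <- s | P j) F j x).
Proof.
move=> sF; elim: s => [|j s IH].
  by apply: eq_smooth (smooth_cst 1) => x _; rewrite big_nil.
case Pj: (P j).
  apply: eq_smooth (smoothM (sF _ Pj) IH) => x _.
  by rewrite big_cons Pj.
by apply: eq_smooth IH => x _; rewrite big_cons Pj.
Qed.

Lemma derivable_expR_comp f x w : differentiable f x ->
  is_derive x w (expR \o f) (expR (f x) * 'D_w f x).
Proof.
move=> df; have de : differentiable (@expR R) (f x).
  by apply/derivable1_diffP; exact: derivable_expR.
have dc : differentiable (expR \o f) x by exact: differentiable_comp.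
apply: DeriveDef; first exact: diff_derivable.
rewrite deriveE // diff_comp // /= deriv1E; last exact/derivable1_diffP.
by rewrite derive1E derive_val -deriveE // mulrC.
Qed.

Lemma smooth_expR f : smooth f -> smooth (fun x => expR (f x)).
Proof.
move=> sf; have d x : O x -> differentiable (fun y => expR (f y)) x.
  move=> Ox; have df := Cn_diff (sf 0) Ox.
  apply: (@differentiable_comp _ _ _ _ f (@expR R)) => //.
  by apply/derivable1_diffP; exact: derivable_expR.
elim => [|k IH]; split => // i.
apply: eq_Cn (CnM IH (smooth_pd i sf k)) => x Ox.
have de := derivable_expR_comp (v i) (Cn_diff (sf 0) Ox).
by rewrite /pd (@derive_val _ _ _ _ _ _ _ de).
Qed.

Lemma smooth_inv f : (forall x, O x -> f x != 0) -> smooth f ->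
  smooth (fun x => (f x)^-1).
Proof.
move=> f0 sf; elim => [|k IH].
  by split => // x Ox; apply: differentiableV; [exact: Cn_diff (sf 0) _|exact: f0].
split=> [x Ox|i].
  by apply: differentiableV; [exact: Cn_diff (sf 0) _|exact: f0].
apply: eq_Cn (CnM (CnM IH IH) (smoothN (smooth_pd i sf) k)) => x Ox.
rewrite /pd [RHS]deriveV; [|exact: f0|exact: Cn_derivable (sf 0) _].
by rewrite /GRing.scale /= mulrN -mulNr; congr (_ * _); rewrite -exprVn expr2.
Qed.

Lemma pd_comm i j f x : smooth f -> O x -> pd i (pd j f) x = pd j (pd i f) x.
Proof.
move=> sf Ox; apply: (derive_comm oO Ox).
- by move=> y Oy; exact: Cn_diff (sf 0) Oy.
- exact: Cn_diff (smooth_pd j sf 0) Ox.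
- exact: Cn_diff (smooth_pd i sf 0) Ox.
Qed.

End Smooth.

(** * The differential ring of smooth functions *)

(** Openness is bundled with the set so that the ring structure below can be
    inferred from the type alone. *)
Record openSet (V : topologicalType) :=
  OpenSet { carrier_of : set V; carrier_open : open carrier_of }.

Section SmoothRing.
Context {R : realType} {V : normedModType R} {I : Type}.
Context (v : I -> V) (U : openSet V).
Local Notation O := (carrier_of U).
Local Notation oO := (carrier_open U).
Implicit Types (f : V -> R) (x : V).

(** Functions are normalized to vanish outside the open set: then functions that
    agree on it are equal, and identities between them can be rewritten under
    the derivations. *)
Record cinf := SFun {
  cinf_val : V -> R;
  cinf_smooth : smooth v O cinf_val;
  cinf_out : forall x, ~ O x -> cinf_val x = 0 }.

HB.instance Definition _ := gen_eqMixin cinf.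
HB.instance Definition _ := gen_choiceMixin cinf.

Lemma cinfP (a b : cinf) :
  (forall x, O x -> cinf_val a x = cinf_val b x) -> a = b.
Proof.
move=> ab; have E : cinf_val a = cinf_val b.
  apply/funext => x; have [Ox|Ox] := pselect (O x); first exact: ab.
  by rewrite !cinf_out.
case: a b ab E => [a sa oa] [b sb ob] /= _ E; subst b.
by congr SFun; exact: Prop_irrelevance.
Qed.

Definition restr f x : R := if pselect (O x) is left _ then f x else 0.

Lemma restrE f x : O x -> restr f x = f x.
Proof. by rewrite /restr; case: pselect. Qed.

Lemma restr_out f x : ~ O x -> restr f x = 0.
Proof. by rewrite /restr; case: pselect. Qed.

Lemma smooth_restr f : smooth v O f -> smooth v O (restr f).
Proof. by apply: (eq_smooth oO) => x Ox; rewrite restrE. Qed.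

Definition mkcinf f (sf : smooth v O f) : cinf :=
  SFun (smooth_restr sf) (restr_out f).

Lemma mkcinfE f (sf : smooth v O f) x : O x -> cinf_val (mkcinf sf) x = f x.
Proof. exact: restrE. Qed.

Definition cinf0 := mkcinf (smooth_cst v oO 0).
Definition cinf1 := mkcinf (smooth_cst v oO 1).
Definition cinfD (a b : cinf) :=
  mkcinf (smoothD oO (cinf_smooth a) (cinf_smooth b)).
Definition cinfN (a : cinf) := mkcinf (smoothN oO (cinf_smooth a)).
Definition cinfM (a b : cinf) :=
  mkcinf (smoothM oO (cinf_smooth a) (cinf_smooth b)).

Fact cinf_addA : associative cinfD.
Proof. by move=> a b c; apply: cinfP => x Ox; rewrite !mkcinfE // addrA. Qed.
Fact cinf_addC : commutative cinfD.
Proof. by move=> a b; apply: cinfP => x Ox; rewrite !mkcinfE // addrC. Qed.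
Fact cinf_add0 : left_id cinf0 cinfD.
Proof. by move=> a; apply: cinfP => x Ox; rewrite !mkcinfE // add0r. Qed.
Fact cinf_addN : left_inverse cinf0 cinfN cinfD.
Proof. by move=> a; apply: cinfP => x Ox; rewrite !mkcinfE // addNr. Qed.

HB.instance Definition _ :=
  GRing.isZmodule.Build cinf cinf_addA cinf_addC cinf_add0 cinf_addN.

Fact cinf_mulA : associative cinfM.
Proof. by move=> a b c; apply: cinfP => x Ox; rewrite !mkcinfE // mulrA. Qed.
Fact cinf_mulC : commutative cinfM.
Proof. by move=> a b; apply: cinfP => x Ox; rewrite !mkcinfE // mulrC. Qed.
Fact cinf_mul1 : left_id cinf1 cinfM.
Proof. by move=> a; apply: cinfP => x Ox; rewrite !mkcinfE // mul1r. Qed.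
Fact cinf_mulD : left_distributive cinfM +%R.
Proof. by move=> a b c; apply: cinfP => x Ox; rewrite !mkcinfE // mulrDl. Qed.

HB.instance Definition _ :=
  GRing.Zmodule_isComPzRing.Build cinf cinf_mulA cinf_mulC cinf_mul1 cinf_mulD.

Section Eval.
Context (x : V) (Ox : O x).

Lemma cinf_valD (a b : cinf) :
  cinf_val (a + b) x = cinf_val a x + cinf_val b x.
Proof. exact: mkcinfE. Qed.
Lemma cinf_valN (a : cinf) : cinf_val (- a) x = - cinf_val a x.
Proof. exact: mkcinfE. Qed.
Lemma cinf_valB (a b : cinf) :
  cinf_val (a - b) x = cinf_val a x - cinf_val b x.
Proof. by rewrite cinf_valD cinf_valN. Qed.
Lemma cinf_valM (a b : cinf) :
  cinf_val (a * b) x = cinf_val a x * cinf_val b x.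
Proof. exact: mkcinfE. Qed.
Lemma cinf_val0 : cinf_val 0 x = 0. Proof. exact: mkcinfE. Qed.
Lemma cinf_val1 : cinf_val 1 x = 1. Proof. exact: mkcinfE. Qed.
Lemma cinf_val_nat m : cinf_val m%:R x = m%:R.
Proof.
by elim: m => [|m IH]; rewrite ?cinf_val0 // -!natr1 cinf_valD IH cinf_val1.
Qed.
Lemma cinf_val_sum (J : finType) (F : J -> cinf) :
  cinf_val (\sum_j F j) x = \sum_j cinf_val (F j) x.
Proof.
by apply: (big_morph (fun a => cinf_val a x) cinf_valD cinf_val0).
Qed.
Lemma cinf_valX (a : cinf) m : cinf_val (a ^+ m) x = cinf_val a x ^+ m.
Proof.
by elim: m => [|m IH]; rewrite ?expr0 ?cinf_val1 // !exprS cinf_valM IH.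
Qed.

End Eval.

Definition sder (i : I) (a : cinf) : cinf :=
  mkcinf (smooth_pd i (cinf_smooth a)).

Lemma sderE i a x : O x -> cinf_val (sder i a) x = 'D_(v i) (cinf_val a) x.
Proof. exact: mkcinfE. Qed.

Lemma sder_derivation i : derivation (sder i).
Proof.
have df (a : cinf) x w : O x -> derivable (cinf_val a) x w.
  by move=> Ox; exact: Cn_derivable (cinf_smooth a 0) Ox.
split=> a b; apply: cinfP => x Ox.
  rewrite cinf_valD // !sderE // -deriveD; [|exact: df..].
  by apply: (eq_pd v oO i) => // y Oy; rewrite cinf_valD.
rewrite cinf_valD // !cinf_valM // !sderE // addrC [X in _ + X]mulrC.
rewrite -[RHS](deriveM (df _ _ _ Ox) (df _ _ _ Ox)).
by apply: (eq_pd v oO i) => // y Oy; rewrite cinf_valM.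
Qed.

Lemma sder_comm i j a : sder i (sder j a) = sder j (sder i a).
Proof.
have E k l x : O x ->
    cinf_val (sder k (sder l a)) x = pd v k (pd v l (cinf_val a)) x.
  move=> Ox; rewrite (sderE k (sder l a) Ox).
  by apply: (eq_pd v oO k _ Ox) => y Oy; exact: sderE.
apply: cinfP => x Ox.
refine (etrans (E i j x Ox) (etrans _ (esym (E j i x Ox)))).
exact: (pd_comm oO i j (cinf_smooth a) Ox).
Qed.

(** Division is needed only by elements with a nonzero constant value. *)
Lemma cinf_regular (c : cinf) (k : R) : k != 0 ->
  (forall x, O x -> cinf_val c x = k) -> forall a : cinf, c * a = 0 -> a = 0.
Proof.
move=> k0 ck a ca; apply: cinfP => x Ox; rewrite cinf_val0 //.
have := congr1 (fun b => cinf_val b x) ca.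
rewrite cinf_val0 // cinf_valM // ck // => /eqP.
by rewrite mulf_eq0 (negPf k0) /= => /eqP.
Qed.

End SmoothRing.

(** * Functions of time and space *)

Section SpaceTime.
Context {R : realType} {n : nat}.
Local Notation X := 'rV[R]_n.
Local Notation E := (R * X)%type.
Implicit Types (F : E -> R) (a : X -> R) (x : X) (t : R).

(** None is the direction of time. *)
Definition st_dir (o : option 'I_n) : E :=
  if o is Some i then (0, delta_mx 0 i) else (1, 0).

Lemma derive_slice_space F t x w :
  'D_((0, w) : E) F (t, x) = 'D_w (fun y => F (t, y)) x.
Proof.
have Q : (fun h : R => h^-1 *: ((F \o shift ((t, x) : E)) (h *: ((0, w) : E)) - F (t, x))) =
  (fun h : R => h^-1 *: (((fun y => F (t, y)) \o shift x) (h *: w) - F (t, x))).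
  apply/funext => h; congr (_ *: (F _ - _)); rewrite /shift /=.
  by congr (_, _); rewrite /= scaler0 add0r.
by rewrite /derive Q.
Qed.

(** The difference quotients coincide, and not only their limits; so
    derivability passes to the slice. *)
Lemma slice_time_quotient F t x : 
  (fun h : R => h^-1 *: ((F \o shift ((t, x) : E)) (h *: ((1, 0) : E)) - F (t, x))) =
  (fun h : R => h^-1 *: (((fun s => F (s, x)) \o shift t) (h *: (1 : R)) - F (t, x))).
Proof.
apply/funext => h; congr (_ *: (F _ - _)); rewrite /shift /=.
by congr (_, _); rewrite /= scaler0 add0r.
Qed.

Lemma is_derive_slice_time F t x : differentiable F ((t, x) : E) ->
  is_derive t (1 : R) (fun s => F (s, x)) ('D_((1, 0) : E) F (t, x)).
Proof.
move=> dF; have := diff_derivable (v := ((1, 0) : E)) dF.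
rewrite /derivable slice_time_quotient => h.
by apply: DeriveDef; rewrite // /derive slice_time_quotient.
Qed.

Lemma differentiable_proj2 (p : E) : differentiable (snd : E -> X) p.
Proof.
by apply: linear_differentiable => q; exact: cvg_snd.
Qed.

Lemma differentiable_proj1 (p : E) : differentiable (fst : E -> R) p.
Proof.
by apply: linear_differentiable => q; exact: cvg_fst.
Qed.

Lemma open_space (U : openSet X) :
  open ([set p | carrier_of U p.2] : set E).
Proof.
apply: (@open_comp _ _ (snd : E -> X)); last exact: carrier_open.
by move=> q _; exact: cvg_snd.
Qed.

Definition spacetime (U : openSet X) : openSet E := OpenSet (@open_space U).

Context (U : openSet X).
Local Notation O := (carrier_of (spacetime U)).
Local Notation oO := (carrier_open (spacetime U)).
Local Notation B := (cinf st_dir (spacetime U)).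

Lemma smooth_onS i a : smooth_on (carrier_of U) a ->
  smooth_on (carrier_of U) (partial i a).
Proof. by move=> sa s x Ux; have := sa (rcons s i) x Ux; rewrite foldr_rcons. Qed.

Lemma smooth_lift a : smooth_on (carrier_of U) a ->
  smooth st_dir O (fun p => a p.2).
Proof.
move=> sa k; have d b (p : E) : smooth_on (carrier_of U) b -> O p ->
    differentiable (fun p : E => b p.2) p.
  move=> sb Op; apply: (@differentiable_comp _ _ _ _ (snd : E -> X) b).
    exact: differentiable_proj2.
  exact: (sb [::]).
elim: k a sa => [|k IH] a sa; split => //; try by move=> p; exact: d.
case=> [i|].
  apply: (eq_Cn oO _ (IH _ (smooth_onS i sa))) => -[t x] Op.
  by rewrite /pd /= derive_slice_space.
apply: (eq_Cn oO _ (smooth_cst st_dir oO 0 k)) => -[t x] Op.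
have := is_derive_slice_time (d _ _ sa Op).
by rewrite /pd /= => /(@derive_val _ _ _ _ _ _ _) <-; rewrite derive_cst.
Qed.

Lemma smooth_time : smooth st_dir O (fun p : E => p.1).
Proof.
case=> [|k]; split => //; try by move=> p _; exact: differentiable_proj1.
case=> [i|].
  apply: (eq_Cn oO _ (smooth_cst st_dir oO 0 k)) => -[t x] Op.
  by rewrite /pd /= derive_slice_space /= derive_cst.
apply: (eq_Cn oO _ (smooth_cst st_dir oO 1 k)) => -[t x] Op.
have := is_derive_slice_time (differentiable_proj1 (t, x)).
by rewrite /pd /= => /(@derive_val _ _ _ _ _ _ _) <-; rewrite derive_id.
Qed.

Lemma time_constant (b : B) x : carrier_of U x -> sder None b = 0 ->
  forall s t, cinf_val b (s, x) = cinf_val b (t, x).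
Proof.
move=> Ux b0 s t.
apply: (@is_derive_0_is_cst _ (fun s => cinf_val b (s, x))) => r.
have Or : O (r, x) by [].
have D := is_derive_slice_time (Cn_diff (cinf_smooth b 0) Or).
have := sderE None b Or; rewrite b0 cinf_val0 // => E0.
by apply: is_derive_eq D _; rewrite -E0.
Qed.

Lemma partial_ev i (b : B) (f : X -> R) t x : carrier_of U x ->
  (forall y, carrier_of U y -> f y = cinf_val b (t, y)) ->
  partial i f x = cinf_val (sder (Some i) b) (t, x).
Proof.
move=> Ux fb; rewrite (sderE (Some i) b (Ux : O (t, x))) /= derive_slice_space.
rewrite /partial; apply: near_eq_derive.
by apply: filterS (open_nbhs_nbhs (conj (carrier_open U) Ux)) => y; exact: fb.
Qed.

End SpaceTime.

(** * The metrics e^(2 t phi) g *)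

Section SmoothMatrix.
Context {R : realType} {V : normedModType R} {I : Type} (v : I -> V).
Context (O : set V) (oO : open O).

Lemma smooth_det m (F : V -> 'M[R]_m) :
  (forall i j, smooth v O (fun x => F x i j)) ->
  smooth v O (fun x => \det (F x)).
Proof.
move=> sF; apply: (smooth_sum oO) => s _.
by apply: (smoothM oO); [exact: smooth_cst | exact: smooth_prod].
Qed.

(** Cramer's rule. *)
Lemma smooth_invmx m (F : V -> 'M[R]_m) :
  (forall x, O x -> F x \in unitmx) ->
  (forall i j, smooth v O (fun x => F x i j)) ->
  forall i j, smooth v O (fun x => invmx (F x) i j).
Proof.
move=> uF sF i j.
apply: (@eq_smooth _ _ _ _ _ oO
  (fun x => (\det (F x))^-1 * ((-1) ^+ (j + i) * \det (row' j (col' i (F x)))))).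
  by move=> x Ox; rewrite /invmx uF // !mxE.
apply: (smoothM oO).
  by apply: smooth_inv => // [x /uF|]; [rewrite unitmxE unitfE | exact: smooth_det].
apply: (smoothM oO); first exact: smooth_cst.
apply: smooth_det => a b; apply: (eq_smooth oO) (sF (lift j a) (lift i b)) => x _.
by rewrite !mxE.
Qed.

End SmoothMatrix.

Section ConformalFlow.
Context {R : realType} {n : nat} (U : openSet 'rV[R]_n).
Local Notation X := 'rV[R]_n.
Local Notation Us := (carrier_of U).
Local Notation B := (cinf (@st_dir R n) (spacetime U)).
Local Notation ev b t x := (cinf_val b ((t, x) : R * X)).
Implicit Types (x : X) (t : R).

Context (phi : X -> R) (g : X -> 'M[R]_n).
Hypothesis phi_smooth : smooth_on Us phi.
Hypothesis g_smooth : forall i j, smooth_on Us (fun x => g x i j).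
Hypothesis g_symm : forall x, Us x -> (g x)^T = g x.
Hypothesis g_unit : forall x, Us x -> g x \in unitmx.

Definition gflow t x : 'M[R]_n := expR (2 * (t * phi x)) *: g x.

Definition cstB (c : R) : B := mkcinf (smooth_cst _ (carrier_open _) c).
Definition liftB a (sa : smooth_on Us a) : B := mkcinf (smooth_lift (U := U) sa).

Lemma smooth_exp_flow (c : R) :
  smooth (@st_dir R n) (carrier_of (spacetime U)) (fun p => expR (c * (p.1 * phi p.2))).
Proof.
have oO := carrier_open (spacetime U).
apply: (smooth_expR oO); apply: (smoothM oO); first exact: smooth_cst.
by apply: (smoothM oO); [exact: smooth_time | exact: smooth_lift].
Qed.

Definition expB (c : R) : B := mkcinf (smooth_exp_flow c).
Definition phiB : B := liftB phi_smooth.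
Definition dB (i : 'I_n) : B -> B := sder (Some i).
Definition tauB : B -> B := sder None.
Lemma tauB_derivation : derivation tauB. Proof. exact: sder_derivation. Qed.
Lemma dB_derivation i : derivation (dB i). Proof. exact: sder_derivation. Qed.

Definition gB : 'M[B]_n := \matrix_(i, j) (expB 2 * liftB (g_smooth i j)).

Lemma cinfPE (a b : B) : (forall t x, Us x -> ev a t x = ev b t x) -> a = b.
Proof. by move=> ab; apply: cinfP => -[t x] Ux; exact: ab. Qed.

Lemma ev_cst c t x : Us x -> ev (cstB c) t x = c.
Proof. by move=> Ux; rewrite mkcinfE. Qed.
Lemma ev_lift a (sa : smooth_on Us a) t x : Us x -> ev (liftB sa) t x = a x.
Proof. by move=> Ux; rewrite mkcinfE. Qed.
Lemma ev_exp c t x : Us x -> ev (expB c) t x = expR (c * (t * phi x)).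
Proof. by move=> Ux; rewrite mkcinfE. Qed.

Lemma ev_g i j t x : Us x -> ev (gB i j) t x = gflow t x i j.
Proof. by move=> Ux; rewrite !mxE cinf_valM // ev_exp // ev_lift. Qed.

Lemma ev_tau f (sf : smooth (@st_dir R n) (carrier_of (spacetime U)) f) t x :
  Us x -> ev (tauB (mkcinf sf)) t x = 'D_1 (fun s => f (s, x)) t.
Proof.
move=> Ux; have Op : carrier_of (spacetime U) (t, x) by [].
refine (etrans (sderE None (mkcinf sf) Op) _).
have E : forall p, carrier_of (spacetime U) p -> cinf_val (mkcinf sf) p = f p.
  by move=> p; exact: mkcinfE.
refine (etrans (eq_pd (@st_dir R n) (carrier_open (spacetime U)) None E Op) _).
have := is_derive_slice_time (Cn_diff (sf 0) Op).
by move/(@derive_val _ _ _ _ _ _ _).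
Qed.

Lemma tau_lift a (sa : smooth_on Us a) : tauB (liftB sa) = 0.
Proof.
by apply: cinfPE => t x Ux; rewrite ev_tau // cinf_val0 //= derive_cst.
Qed.

Lemma tau_exp c : tauB (expB c) = cstB c * phiB * expB c.
Proof.
apply: cinfPE => t x Ux; rewrite ev_tau // !cinf_valM // ev_cst // ev_lift // ev_exp //.
have dE : is_derive t 1 (fun s : R => c * (s * phi x)) (c * phi x).
  have -> : (fun s : R => c * (s * phi x)) = (c * phi x) \*: (id : R -> R).
    by apply/funext => s; rewrite /= /GRing.scale /=; ring.
  by apply: is_derive_eq; rewrite /GRing.scale /= mulr1.
have df : differentiable (fun s : R => c * (s * phi x)) t.
  by apply/derivable1_diffP; case: dE.
have := derivable_expR_comp (1 : R) df; rewrite (@derive_val _ _ _ _ _ _ _ dE).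
by move/(@derive_val _ _ _ _ _ _ _) => ->; rewrite mulrC.
Qed.

Lemma tauB_g i j : tauB (gB i j) = 2 * phiB * gB i j.
Proof.
have two : cstB 2 = 2.
  by apply: cinfPE => t x Ux; rewrite ev_cst // cinf_val_nat.
rewrite mxE (derM tauB_derivation).
by rewrite tau_lift tau_exp two; ring.
Qed.

Lemma gflow_unit t x : Us x -> gflow t x \in unitmx.
Proof.
move=> Ux; rewrite unitmxZ ?g_unit //.
by rewrite unitfE gt_eqF // expR_gt0.
Qed.

Lemma smooth_gflow i j :
  smooth (@st_dir R n) (carrier_of (spacetime U)) (fun p => gflow p.1 p.2 i j).
Proof.
have oO := carrier_open (spacetime U).
apply: (eq_smooth oO) (smoothM oO (smooth_exp_flow 2) (smooth_lift (g_smooth i j))).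
by move=> p Op; rewrite mxE.
Qed.

Lemma smooth_gflow_inv i j :
  smooth (@st_dir R n) (carrier_of (spacetime U))
    (fun p => invmx (gflow p.1 p.2) i j).
Proof.
apply: smooth_invmx; [exact: carrier_open| |exact: smooth_gflow].
by move=> p Op; exact: gflow_unit.
Qed.

Definition gupB : 'M[B]_n := \matrix_(i, j) mkcinf (smooth_gflow_inv i j).

Lemma ev_gup i j t x : Us x -> ev (gupB i j) t x = invmx (gflow t x) i j.
Proof. by move=> Ux; rewrite mxE mkcinfE. Qed.

Lemma gB_sym : gB^T = gB.
Proof.
apply/matrixP => i j; rewrite mxE; apply: cinfPE => t x Ux; rewrite !ev_g //.
by rewrite !mxE -{1}(g_symm Ux) mxE.
Qed.

Lemma gupB_sym : gupB^T = gupB.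
Proof.
apply/matrixP => i j; rewrite mxE; apply: cinfPE => t x Ux; rewrite !ev_gup //.
by rewrite -[in RHS](trmxK (gflow t x)) -trmx_inv linearZ /= g_symm // mxE.
Qed.

Lemma gupB_gB : gupB *m gB = 1%:M.
Proof.
apply/matrixP => i j; apply: cinfPE => t x Ux.
transitivity ((invmx (gflow t x) *m gflow t x) i j).
  rewrite !mxE cinf_val_sum //; apply: eq_bigr => k _.
  by rewrite cinf_valM // ev_g // ev_gup.
by rewrite mulVmx ?gflow_unit // !mxE; case: (i == j); rewrite ?cinf_val1 ?cinf_val0.
Qed.

Lemma gB_gupB : gB *m gupB = 1%:M.
Proof.
by rewrite -[LHS]trmxK trmx_mul gB_sym gupB_sym gupB_gB trmx1.
Qed.

Definition GamB := levi_civita dB gB gupB (cstB 2^-1).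
Definition JB : B := cstB (2 * (n%:R - 1))^-1 * scal dB gB gupB GamB.
Definition PB (i j : 'I_n) : B :=
  cstB (n%:R - 2)^-1 * (ric dB gB gupB GamB i j - JB * gB i j).

Section AtTime.
Context (t : R).
Local Notation gt := (gflow t).

(** The function f of space is the value at time t of the element b. Each
    quantity attached to the metric at time t is represented by its algebraic
    counterpart. *)
Definition rep (f : X -> R) (b : B) := forall x, Us x -> f x = ev b t x.

Lemma rep_partial i f b : rep f b -> rep (partial i f) (dB i b).
Proof. by move=> fb x Ux; exact: partial_ev. Qed.

Lemma rep_g i j : rep (gdn gt i j) (gB i j).
Proof. by move=> x Ux; rewrite ev_g. Qed.

Lemma rep_gup i j : rep (gup gt i j) (gupB i j).
Proof. by move=> x Ux; rewrite ev_gup. Qed.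

Lemma rep_sum (J : finType) (f : J -> X -> R) (b : J -> B) :
  (forall j, rep (f j) (b j)) -> rep (fun x => \sum_j f j x) (\sum_j b j).
Proof.
by move=> fb x Ux; rewrite cinf_val_sum //; apply: eq_bigr => j _; exact: fb.
Qed.

Lemma repD f1 f2 b1 b2 : rep f1 b1 -> rep f2 b2 ->
  rep (fun x => f1 x + f2 x) (b1 + b2).
Proof. by move=> h1 h2 x Ux; rewrite cinf_valD // h1 // h2. Qed.
Lemma repN f b : rep f b -> rep (fun x => - f x) (- b).
Proof. by move=> h x Ux; rewrite cinf_valN // h. Qed.
Lemma repB f1 f2 b1 b2 : rep f1 b1 -> rep f2 b2 ->
  rep (fun x => f1 x - f2 x) (b1 - b2).
Proof. by move=> h1 h2; apply: repD => //; exact: repN. Qed.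
Lemma repM f1 f2 b1 b2 : rep f1 b1 -> rep f2 b2 ->
  rep (fun x => f1 x * f2 x) (b1 * b2).
Proof. by move=> h1 h2 x Ux; rewrite cinf_valM // h1 // h2. Qed.
Lemma rep_cst c : rep (fun=> c) (cstB c).
Proof. by move=> x Ux; rewrite ev_cst. Qed.
Lemma rep_nat m : rep (fun=> m%:R) m%:R.
Proof. by move=> x Ux; rewrite cinf_val_nat. Qed.
Lemma repX f b m : rep f b -> rep (fun x => f x ^+ m) (b ^+ m).
Proof. by move=> h x Ux; rewrite cinf_valX // h. Qed.

Lemma rep_tr (S : 'I_n -> 'I_n -> X -> R) SB :
  (forall i j, rep (S i j) (SB i j)) ->
  rep (fun x => \sum_i \sum_j gup gt i j x * S i j x) (tr gupB SB).
Proof.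
move=> h; apply: rep_sum => i; apply: rep_sum => j.
by apply: repM; [exact: rep_gup | exact: h].
Qed.

Lemma rep_christoffel k i j : rep (christoffel gt k i j) (GamB k i j).
Proof.
apply: repM; first exact: rep_cst.
apply: rep_sum => m; apply: repM; first exact: rep_gup.
by apply: repB; [apply: repD|]; apply: rep_partial; exact: rep_g.
Qed.

Lemma rep_conn k i (w : 'I_n -> X -> R) wB : (forall i, rep (w i) (wB i)) ->
  rep (fun x => \sum_m christoffel gt m k i x * w m x) (conn GamB k i wB).
Proof.
move=> h; apply: rep_sum => m; apply: repM => //; exact: rep_christoffel.
Qed.

Lemma rep_nabla1 (w : 'I_n -> X -> R) wB k i : (forall i, rep (w i) (wB i)) ->
  rep (nabla1 gt w k i) (nab1 dB GamB wB k i).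
Proof.
by move=> h; apply: repB; [exact: rep_partial | exact: rep_conn].
Qed.

Lemma rep_nabla2 (T : 'I_n -> 'I_n -> X -> R) TB k i j :
  (forall i j, rep (T i j) (TB i j)) ->
  rep (nabla2 gt T k i j) (nab2 dB GamB TB k i j).
Proof.
move=> h; apply: repB; first exact: rep_partial.
move=> x Ux; refine (etrans _ (repD
  (@rep_conn k i (fun m => T m j) (fun m => TB m j) (fun m => h m j))
             (@rep_conn k j (T i) (TB i) (h i)) Ux)).
exact: big_split.
Qed.

Lemma rep_nabla3 (T : 'I_n -> 'I_n -> 'I_n -> X -> R) TB l k i j :
  (forall k i j, rep (T k i j) (TB k i j)) ->
  rep (nabla3 gt T l k i j) (nab3 dB GamB TB l k i j).
Proof.
move=> h; apply: repB; first exact: rep_partial.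
move=> x Ux; refine (etrans _ (repD (repD
  (@rep_conn l k (fun m => T m i j) (fun m => TB m i j) (fun m => h m i j))
  (@rep_conn l i (fun m => T k m j) (fun m => TB k m j) (fun m => h k m j)))
  (@rep_conn l j (T k i) (TB k i) (h k i)) Ux)).
by rewrite !big_split.
Qed.

Lemma rep_grad f b : rep f b -> forall i, rep (grad_form f i) (df dB b i).
Proof. by move=> fb i; exact: rep_partial. Qed.

Lemma rep_codiff (w : 'I_n -> X -> R) wB : (forall i, rep (w i) (wB i)) ->
  rep (codiff gt w) (- dvg dB gupB GamB wB).
Proof.
by move=> h; apply: repN; apply: rep_tr => i j; exact: rep_nabla1.
Qed.

Lemma rep_laplacian f b : rep f b -> rep (laplacian gt f) (lap dB gupB GamB b).
Proof.
by move=> h; apply: rep_tr => i j; apply: rep_nabla1; exact: rep_grad.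
Qed.

Lemma rep_sharp_act (T : 'I_n -> 'I_n -> X -> R) TB (w : 'I_n -> X -> R) wB j :
  (forall i j, rep (T i j) (TB i j)) -> (forall i, rep (w i) (wB i)) ->
  rep (sharp_act gt T w j) (act gupB TB wB j).
Proof.
move=> hT hw x Ux.
rewrite -(@rep_tr (fun i k x => T i j x * w k x)) //; last first.
  by move=> i k; exact: repM.
apply: eq_bigr => i _; rewrite mulr_sumr; apply: eq_bigr => k _; ring.
Qed.

Lemma rep_curvature k i j m :
  rep (curvature gt k i j m) (curvmx dB GamB k i j m).
Proof.
rewrite curvE; apply: repD.
  by apply: repB; apply: rep_partial; exact: rep_christoffel.
apply: rep_sum => a; apply: repB; apply: repM; exact: rep_christoffel.
Qed.

Lemma rep_riemann k i j l : rep (riemann gt k i j l) (riem dB gB GamB k i j l).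
Proof.
rewrite riemE; apply: rep_sum => m; apply: repM; first exact: rep_g.
exact: rep_curvature.
Qed.

Lemma rep_ricci i j : rep (ricci gt i j) (ric dB gB gupB GamB i j).
Proof. by apply: rep_tr => k l; exact: rep_riemann. Qed.

Lemma rep_scalar_curvature :
  rep (scalar_curvature gt) (scal dB gB gupB GamB).
Proof. by apply: rep_tr => i j; exact: rep_ricci. Qed.

Lemma rep_J : rep (Jcurv gt) JB.
Proof.
move=> x Ux; rewrite /Jcurv mulrC; move: x Ux.
by apply: repM; [exact: rep_cst | exact: rep_scalar_curvature].
Qed.

Lemma rep_P i j : rep (schouten gt i j) (PB i j).
Proof.
move=> x Ux; rewrite /schouten mulrC; move: x Ux.
apply: repM; first exact: rep_cst.
apply: repB; first exact: rep_ricci.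
by apply: repM; [exact: rep_J | exact: rep_g].
Qed.

Lemma rep_schouten_sq i j : rep (schouten_sq gt i j) (schouten2 gupB PB i j).
Proof.
move=> x Ux.
rewrite -(@rep_tr (fun k l x => schouten gt i k x * schouten gt l j x)) //.
  by apply: eq_bigr => k _; apply: eq_bigr => l _; ring.
by move=> k l; apply: repM; exact: rep_P.
Qed.

Lemma rep_schouten_norm2 : rep (schouten_norm2 gt) (norm2P gupB PB).
Proof.
move=> x Ux.
rewrite -(@rep_tr (fun i k x => \sum_j \sum_l gup gt j l x *
   (schouten gt i j x * schouten gt k l x))) //; last first.
  by move=> i k; apply: rep_tr => j l; apply: repM; exact: rep_P.
apply: eq_bigr => i _; rewrite exchange_big; apply: eq_bigr => k _ /=.
rewrite mulr_sumr; apply: eq_bigr => j _; rewrite mulr_sumr.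
by apply: eq_bigr => l _; ring.
Qed.

Lemma rep_weyl k i j l : rep (weyl gt k i j l) (weyl_alg dB gB GamB PB k i j l).
Proof.
apply: repB; first exact: rep_riemann.
by apply: repB; [apply: repD; [apply: repB|]|]; apply: repM;
  (exact: rep_g || exact: rep_P).
Qed.

Lemma rep_bach i j : rep (bach gt i j) (bach_alg dB gB gupB GamB PB i j).
Proof.
apply: repD; first apply: repB.
- apply: rep_tr => k l; apply: rep_nabla3 => *; apply: rep_nabla2 => *.
  exact: rep_P.
- apply: rep_tr => k l; apply: rep_nabla3 => *; apply: rep_nabla2 => *.
  exact: rep_P.
move=> x Ux.
rewrite -(@rep_tr (fun k a x => \sum_l \sum_b gup gt l b x *
   (schouten gt a b x * weyl gt k i j l x))) //; last first.
  move=> k a; apply: rep_tr => l b; apply: repM; first exact: rep_P.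
  exact: rep_weyl.
apply: eq_bigr => k _.
under [RHS]eq_bigr => a _ do rewrite mulr_sumr.
rewrite exchange_big; apply: eq_bigr => l _ /=.
rewrite mulr_suml; apply: eq_bigr => a _; rewrite mulr_suml mulr_sumr.
by apply: eq_bigr => b _; ring.
Qed.

End AtTime.

End ConformalFlow.

(** * Conformal covariance in dimension six *)

Section Dimension6Flow.
Context {R : realType} (U : openSet 'rV[R]_6).
Local Notation X := 'rV[R]_6.
Local Notation Us := (carrier_of U).
Local Notation B := (cinf (@st_dir R 6) (spacetime U)).
Context (phi : X -> R) (g : X -> 'M[R]_6) (u : X -> R).
Hypothesis phi_smooth : smooth_on Us phi.
Hypothesis g_smooth : forall i j, smooth_on Us (fun x => g x i j).
Hypothesis g_symm : forall x, Us x -> (g x)^T = g x.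
Hypothesis g_unit : forall x, Us x -> g x \in unitmx.
Hypothesis u_smooth : smooth_on Us u.

Local Notation dB := (@dB R 6 U).
Local Notation gB := (gB phi_smooth g_smooth).
Local Notation gupB := (gupB phi_smooth g_smooth g_unit).
Local Notation GamB := (GamB phi_smooth g_smooth g_unit).
Local Notation JB := (JB phi_smooth g_smooth g_unit).
Local Notation PB := (PB phi_smooth g_smooth g_unit).
Local Notation phiB := (phiB phi_smooth).
Local Notation rep t := (@rep R 6 U t).
Local Notation gt t := (gflow phi g t).

Section Operators.
Context (t : R).

Lemma rep_yamabe f b : rep t f b ->
  rep t (yamabe (gt t) f) (yam dB gupB GamB JB b).
Proof.
move=> h x Ux; rewrite /yamabe.
have -> : 6%:R / 2 - 1 = 2%:R :> R by field.
move: x Ux; apply: repB; first exact: rep_laplacian.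
by apply: repM => //; apply: repM; [exact: rep_nat | exact: rep_J].
Qed.

Lemma rep_paneitz f b : rep t f b ->
  rep t (paneitz (gt t) f) (pan dB gB gupB GamB PB JB b).
Proof.
move=> h x Ux; rewrite /paneitz.
have -> : 6%:R / 2 - 2 = 1 :> R by field.
have -> : 6%:R / 2 = 3%:R :> R by field.
have E : (fun i j y => (6%:R - 2) * Jcurv (gt t) y * gdn (gt t) i j y
                     - 4 * schouten (gt t) i j y) =
    (fun i j y => 4%:R * Jcurv (gt t) y * gdn (gt t) i j y
                     - 4%:R * schouten (gt t) i j y).
  apply/funext => i; apply/funext => j; apply/funext => y.
  by congr (_ * _ * _ - _); ring.
rewrite E mul1r; move: x Ux; apply: repD; first apply: repD.
- by apply: rep_laplacian; exact: rep_laplacian.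
- apply: rep_codiff => j; apply: rep_sharp_act; last exact: rep_grad.
  move=> i k; apply: repB; apply: repM; try exact: rep_nat.
  + by apply: repM; [exact: rep_nat | exact: rep_J].
  + exact: rep_g.
  + exact: rep_P.
apply: repM => //; apply: repB; first apply: repB.
- by apply: repM; [exact: rep_nat | apply: repX; exact: rep_J].
- by apply: repM; [exact: rep_nat | exact: rep_schouten_norm2].
by apply: rep_laplacian; exact: rep_J.
Qed.

Lemma rep_P6 f b : rep t f b ->
  rep t (P6_local (gt t) f) (P6_alg dB gB gupB GamB PB JB b).
Proof.
have repK f' b' : rep t f' b' -> rep t
    (fun y => 2%:R * (yamabe (gt t) (paneitz (gt t) f') y
                    + paneitz (gt t) (yamabe (gt t) f') y)
      - 3%:R * yamabe (gt t) (yamabe (gt t) (yamabe (gt t) f')) y)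
    (opK dB gB gupB GamB PB JB b').
  move=> h; apply: repB; apply: repM; try exact: rep_nat; first apply: repD.
  - by apply: rep_yamabe; exact: rep_paneitz.
  - by apply: rep_paneitz; exact: rep_yamabe.
  by do 3!apply: rep_yamabe.
have rep_dop T TB f' b' : (forall i j, rep t (T i j) (TB i j)) -> rep t f' b' ->
    rep t (fun x => - codiff (gt t) (sharp_act (gt t) T (grad_form f')) x)
          (dop dB gupB GamB TB b').
  move=> hT h; rewrite /dop -[dvg _ _ _ _]opprK; apply: repN.
  by apply: rep_codiff => j; apply: rep_sharp_act => //; exact: rep_grad.
move=> h x Ux; rewrite /P6_local /nonconstant_part -(mulrN 48) -(mulrN 8).
move: x Ux; apply: repD; first apply: repD.
- apply: repB; first exact: repK.
  by apply: repM => //; apply: repK => y Uy; rewrite cinf_val1.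
- by apply: repM; [exact: rep_nat | apply: rep_dop => // i j; exact: rep_schouten_sq].
by apply: repM; [exact: rep_nat | apply: rep_dop => // i j; exact: rep_bach].
Qed.

End Operators.

(** The element expB 6 * Q below has time derivative zero, by [tau_P6]. *)
Theorem P6_flow_invariant x : Us x ->
  expR (6 * phi x) * P6_local (gt 1) u x = P6_local (gt 0) u x.
Proof.
have k3 : 6%:R - 1 != 0 :> R.
  have -> : 6%:R - 1 = 5%:R :> R by ring.
  by rewrite pnatr_eq0.
have k2 : 6%:R - 2 != 0 :> R.
  have -> : 6%:R - 2 = 4%:R :> R by ring.
  by rewrite pnatr_eq0.
have k1 : 2 * (6%:R - 1) != 0 :> R by rewrite mulf_neq0 // pnatr_eq0.
move=> Ux; pose uB : B := liftB u_smooth.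
pose Q : B := P6_alg dB gB gupB GamB PB JB uB.
have half2 : cstB U 2^-1 + cstB U 2^-1 = 1.
  apply: cinfP => p Op; rewrite cinf_valD // cinf_val1 // !mkcinfE //.
  by field.
have invc (c : B) (k : R) : k != 0 ->
    (forall p, carrier_of (spacetime U) p -> cinf_val c p = k) ->
    c * cstB U k^-1 = 1.
  move=> k0 ck; apply: cinfP => p Op.
  by rewrite cinf_valM // cinf_val1 // mkcinfE // ck // divff.
have v1 p : carrier_of (spacetime U) p ->
    cinf_val (2 * (6%:R - 1) : B) p = 2 * (6%:R - 1).
  by move=> Op; rewrite cinf_valM // cinf_valB // !cinf_val_nat // cinf_val1.
have v2 p : carrier_of (spacetime U) p ->
    cinf_val (6%:R - 2 : B) p = 6%:R - 2.
  by move=> Op; rewrite cinf_valB // !cinf_val_nat.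
have six : cstB U 6 = 6.
  by apply: cinfP => p Op; rewrite mkcinfE // cinf_val_nat.
have hQ : @tauB R 6 U Q + 6 * phiB * Q = 0.
  apply: (@tau_P6 B 6 dB gB gupB GamB).
  - exact: dB_derivation.
  - by move=> i j f; exact: sder_comm.
  - exact: gB_sym.
  - exact: gupB_sym.
  - exact: gupB_gB.
  - exact: gB_gupB.
  - by move=> m i j; apply: levi_civita_sym; exact: gB_sym.
  - move=> k; apply: levi_civita_metric => //.
    + exact: gB_sym.
    + exact: gupB_sym.
    + exact: gupB_gB.
  - move=> a aa; apply: (@cinf_regular _ _ _ _ _ (2%:R : B) 2) => //.
    + by move=> p Op; rewrite cinf_val_nat.
    + by rewrite mulr_natl mulr2n.
  - move=> a; apply: (@cinf_regular _ _ _ _ _ (6%:R - 1 : B) (6%:R - 1)).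
    + exact: k3.
    + by move=> p Op; rewrite cinf_valB // cinf_val_nat // cinf_val1.
  - by move=> a; apply: (cinf_regular k2 v2).
  - by rewrite /JB mulrA (invc _ _ k1 v1) mul1r.
  - by move=> i j; rewrite /PB mulrA (invc _ _ k2 v2) mul1r subrK.
  - exact: tauB_derivation.
  - by move=> i f; exact: sder_comm.
  - exact: tauB_g.
  - by [].
  - exact: tau_lift.
have tQ : @tauB R 6 U (expB phi_smooth 6 * Q) = 0.
  rewrite (derM (@tauB_derivation R 6 U)) tau_exp six.
  by rewrite -[RHS](mulr0 (expB phi_smooth 6)) -hQ; ring.
have := time_constant Ux tQ 1 0.
have ru t : rep t u uB by move=> y Uy; rewrite ev_lift.
rewrite !cinf_valM // !ev_exp // -!(rep_P6 (ru _) Ux).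
by rewrite mul1r mul0r mulr0 expR0 mul1r.
Qed.

End Dimension6Flow.

Unset Implicit Arguments.

Theorem mainTheorem3 (R : realType) (M : smoothManifold R 6)
  (g : bilinear_field M) (phi u : M -> R) :
  riemannian_metric g -> smooth_function phi -> smooth_function u ->
  forall (c : chart M) (p : M), dom c p ->
    expR (6 * phi p) * P6 (conformal_metric phi g) c u p = P6 g c u p.
Proof.
move=> [gs gsym gpos _] sphi su c p cp.
pose U := OpenSet (@open_img _ _ M c); pose x := to_chart c p.
have Ux : carrier_of U x by exact: to_chart_img.
(* a row vector in the kernel would be isotropic *)
have g_unit y : carrier_of U y -> g c y \in unitmx.
  move=> Uy; rewrite -row_free_unit -kermx_eq0; apply/negPn/negP.
  move=> /rowV0Pn[v vk v0]; have := gpos c y Uy v v0.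
  by move/sub_kermxP: vk => ->; rewrite mul0mx mxE ltxx.
have := @P6_flow_invariant R U (phi \o of_chart c) (g c) (u \o of_chart c)
  (sphi c) (gs c) (gsym c) g_unit (su c) x Ux.
have E1 : gflow (phi \o of_chart c) (g c) 1 = conformal_metric phi g c.
  by apply/funext => y; rewrite /gflow mul1r.
have E0 : gflow (phi \o of_chart c) (g c) 0 = g c.
  by apply/funext => y; rewrite /gflow mul0r mulr0 expR0 scale1r.
by rewrite E0 E1 /= to_chartK.
Qed.
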